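(* Let $\mathcal{T}$ be the class of all Pólya trees, and let $\operatorname{MSET}^{(\ge 2)}(\mathcal{T})$ be the class of all multisets (forests) of Pólya trees in which each tree appears at least twice if it appears at all. Let $D(z)=\sum_{n\ge 0}d_nz^n=\exp\left(\sum_{i\ge 2}\frac{T(z^i)}{i}\right)$, where $T(z)$ is the ordinary generating function of Pólya trees. Then for all $n\ge 0$ $$d_n=\sum_{\substack{F\in \operatorname{MSET}^{(\ge 2)}(\mathcal{T})\\ |F|=n}}\frac{|\{\sigma\in\operatorname{Aut}(F) : \sigma_1=0\}|}{|\operatorname{Aut}(F)|},$$ where $\operatorname{Aut}(F)$ is the automorphism group of $F$. Furthermore, the polynomial $t_{c,n}(u)$ associated to $C$-trees in Pólya trees of size $n$ is given by $$t_{c,n}(u)=\sum_{T\in\mathcal{T},\ |T|=n}t_T(u),\qquad\text{where}\qquad t_T(u)=\frac{1}{|\operatorname{Aut}(T)|}\sum_{\sigma\in\operatorname{Aut}(T)}u^{\sigma_1}.$$ In particular, for all $T\in\mathcal{T}$ we have $t_T'(1)=|\mathcal{P}(T)|$, where $\mathcal{P}(T)$ is the set of all trees which are obtained by pointing (or coloring) one single node in $T$.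
   Context: A Pólya tree is a rooted unlabelled non-plane tree (an isomorphism class of finite rooted trees with at least one node); its size $|T|$ is its number of nodes. The size $|F|$ of a forest (multiset of Pólya trees) is its total number of nodes; the empty forest, of size $0$, belongs to $\operatorname{MSET}^{(\ge 2)}(\mathcal{T})$. Let $t_n$ be the number of Pólya trees of size $n$ and $T(z)=\sum_{n\ge1}t_nz^n$; it satisfies $T(z)=z\exp\left(\sum_{i\ge1}T(z^i)/i\right)$. Automorphisms are those of rooted trees, respectively forests of rooted trees, regarded as permutations of the nodes (roots are mapped to roots, and components of a forest may be permuted). For a permutation $\sigma$, $\sigma_1$ is the number of fixed points (cycles of length 1), i.e. the number of nodes fixed by $\sigma$. The polynomials $t_{c,n}(u)$ are defined as $t_{c,n}(u)=[z^n]T_c(z,u)$, where $T_c(z,u)$ is the unique formal power series in $z$ (with coefficients polynomials in $u$ and zero constant term) satisfying $T_c(z,u)=zu\exp(T_c(z,u))D(z)$. (The coefficient of $u^k$ in $t_{c,n}(u)$ is the cumulative weight of all $C$-trees of size $k$ contained in Pólya trees of size $n$.) Elements of $\mathcal{P}(T)$ are rooted unlabelled non-plane trees with one distinguished node, considered up to isomorphism. *)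

(* Defs.v *)
(* MathComp world. *)
From HB Require Import structures.
From mathcomp Require Import all_boot all_order all_algebra all_fingroup.

Set Implicit Arguments.
Unset Strict Implicit.
Unset Printing Implicit Defensive.

Import GRing.Theory.
Local Open Scope ring_scope.

(* A map p : V -> option V is read as a parent map: p v = Some w means that w
   is the parent of v, and p v = None means that v is a root. *)
Definition pmap (V : finType) := {ffun V -> option V}.

Definition parent_rel (V : finType) (p : pmap V) : rel V :=
  fun v w => p v == Some w.

(* A node from which a root can be reached cannot lie above a cycle of p, so
   this is acyclicity: p is a rooted forest with node set V. *)
Definition rforest (V : finType) (p : pmap V) : bool :=
  [forall v, exists r, (p r == None) && connect (parent_rel p) v r].

Definition rtree (V : finType) (p : pmap V) : bool :=
  rforest p && (#|[set r | p r == None]| == 1)%N.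

(* s is an isomorphism from p to q: it maps roots to roots and parents to
   parents. *)
Definition morph (V : finType) (p q : pmap V) (s : {perm V}) : bool :=
  [forall v, q (s v) == omap s (p v)].

Definition iso (V : finType) (p q : pmap V) : bool :=
  [exists s : {perm V}, morph p q s].

Definition Aut_pmap (V : finType) (p : pmap V) : {set {perm V}} :=
  [set s | morph p p s].

Lemma Aut_pmap_group_set (V : finType) (p : pmap V) : group_set (Aut_pmap p).
Proof.
apply/group_setP; split=> [|s t].
  by rewrite inE; apply/forallP=> v; rewrite perm1; case: (p v) => //= w;
     rewrite perm1.
rewrite !inE => /forallP hs /forallP ht; apply/forallP=> v.
rewrite permM (eqP (ht _)) (eqP (hs _)).
by case: (p v) => //= w; rewrite permM.
Qed.
Canonical Aut_pmap_group (V : finType) (p : pmap V) :=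
  Group (Aut_pmap_group_set p).

(* sigma_1 *)
Definition fixn (V : finType) (s : {perm V}) : nat := #|[set v | s v == v]|.

Definition iso_class (V : finType) (p : pmap V) : {set pmap V} :=
  [set q | iso p q].

Definition is_ptree (n : nat) (C : {set pmap 'I_n}) : bool :=
  C \in [set iso_class p | p : pmap 'I_n & rtree p].

(* Polya trees of size n: isomorphism classes of rooted trees on {0,..,n-1}. *)
Definition ptree (n : nat) := {C : {set pmap 'I_n} | is_ptree C}.

Lemma ptree_inhab (n : nat) (T : ptree n) : exists p, p \in val T.
Proof.
case: T => C /= /imsetP[p _ ->]; exists p.
rewrite inE; apply/existsP; exists 1%g.
by apply/forallP=> v; rewrite perm1; case: (p v) => //= w; rewrite perm1.
Qed.

(* A representative; Aut and the fixed point counts do not depend on it, up to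
   conjugation by an isomorphism. *)
Definition rep (n : nat) (T : ptree n) : pmap 'I_n := xchoose (ptree_inhab T).

Lemma repP (n : nat) (T : ptree n) : rep T \in val T.
Proof. exact: (xchooseP (ptree_inhab T)). Qed.

(* Isomorphism classes of pairs (rooted tree, distinguished node). *)
Definition pointed_iso (V : finType) (x y : pmap V * V) : bool :=
  [exists s : {perm V}, morph x.1 y.1 s && (s x.2 == y.2)].

Definition pointed_class (V : finType) (x : pmap V * V) : {set pmap V * V} :=
  [set y | pointed_iso x y].

(* The set P(T). *)
Definition pointings (n : nat) (T : ptree n) : {set {set pmap 'I_n * 'I_n}} :=
  [set pointed_class (p, v) | p in val T, v in 'I_n].

Definition ptree_upto (n : nat) := {k : 'I_n.+1 & ptree k}.

(* Multisets of Polya trees of total size n, given by their multiplicities.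
   As every Polya tree has at least one node, only trees of size at most n
   can occur, and with multiplicity at most n. *)
Definition mset_ptree (n : nat) :=
  {F : {ffun ptree_upto n -> 'I_n.+1} |
     (\sum_(T : ptree_upto n) F T * tag T)%N == n}.

Definition mset_ge2 (n : nat) (F : mset_ptree n) : bool :=
  [forall T : ptree_upto n, (val F T != 1%N :> nat)].

(* Nodes of the disjoint union of F: a tree T, the index of a copy of T, and a
   node of T. *)
Definition fnode (n : nat) (F : mset_ptree n) : finType :=
  {T : ptree_upto n & ('I_(val F T) * 'I_(tag T))%type}.

Definition fpmap (n : nat) (F : mset_ptree n) : pmap (fnode F) :=
  [ffun x : fnode F =>
     omap (fun w => Tagged (fun T : ptree_upto n =>
                              ('I_(val F T) * 'I_(tag T))%type)
                           ((tagged x).1, w))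
          (rep (tagged (tag x)) (tagged x).2)].

(* Formal power series over R, as coefficient sequences. *)
Definition fps (R : Type) := nat -> R.

Definition fps_one (R : comUnitRingType) : fps R := fun n => (n == 0%N)%:R.

Definition fps_mul (R : comUnitRingType) (A B : fps R) : fps R :=
  fun n => \sum_(i < n.+1) A i * B (n - i)%N.

Definition fps_pow (R : comUnitRingType) (A : fps R) (k : nat) : fps R :=
  iter k (fps_mul A) (@fps_one R).

(* exp(A) = \sum_k A^k / k! for A with zero constant term; the powers k > n
   do not contribute to the coefficient of z^n. Only meaningful when every k!
   is a unit of R, as in rat and in {poly rat}. *)
Definition fps_exp (R : comUnitRingType) (A : fps R) : fps R :=
  fun n => \sum_(k < n.+1) (k`!%:R)^-1 * fps_pow A k n.

(* A(z^i), for i > 0 *)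
Definition fps_zpow (R : comUnitRingType) (A : fps R) (i : nat) : fps R :=
  fun n => if (i %| n)%N then A (n %/ i)%N else 0.

(* z A(z) *)
Definition fps_shift (R : comUnitRingType) (A : fps R) : fps R :=
  fun n => if n is m.+1 then A m else 0.

Definition Tser : fps rat := fun n => #|{: ptree n}|%:R.

(* \sum_(i >= 2) T(z^i) / i; as T has zero constant term, the indices i > n do
   not contribute to the coefficient of z^n. *)
Definition Tser_tail : fps rat :=
  fun n => \sum_(2 <= i < n.+1) fps_zpow Tser i n / i%:R.

Definition Dser : fps rat := fps_exp Tser_tail.

(* z u exp(A) D(z), with u the variable of {poly rat} *)
Definition Tc_rhs (A : fps {poly rat}) : fps {poly rat} :=
  fps_shift (fun n => 'X * fps_mul (fps_exp A) (fun m => (Dser m)%:P) n).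

(* The defining property of T_c(z,u), see is_Tc_exists and is_Tc_unique. *)
Definition is_Tc (A : fps {poly rat}) : Prop :=
  A 0%N = 0 /\ forall n, A n = Tc_rhs A n.

Lemma fps_mul_local (R : comUnitRingType) (A A' B B' : fps R) n :
  (forall i, (i <= n)%N -> A i = A' i) -> (forall i, (i <= n)%N -> B i = B' i) ->
  fps_mul A B n = fps_mul A' B' n.
Proof.
move=> eA eB; apply: eq_bigr => i _; congr (_ * _).
  by apply: eA; rewrite -ltnS.
by apply: eB; exact: leq_subr.
Qed.

Lemma fps_exp_local (R : comUnitRingType) (A A' : fps R) n :
  (forall i, (i <= n)%N -> A i = A' i) -> fps_exp A n = fps_exp A' n.
Proof.
move=> eA; apply: eq_bigr => k _; congr (_ * _).
have pow_local j m : (m <= n)%N -> fps_pow A j m = fps_pow A' j m.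
  elim: j m => [//|j IHj] m le_mn; rewrite /fps_pow !iterS.
  apply: fps_mul_local => i le_im; first exact: eA (leq_trans le_im le_mn).
  exact: IHj (leq_trans le_im le_mn).
exact: pow_local.
Qed.

Lemma Tc_rhs_local (A A' : fps {poly rat}) n :
  (forall i, (i < n)%N -> A i = A' i) -> Tc_rhs A n = Tc_rhs A' n.
Proof.
case: n => [_|n eA]; first by [].
rewrite /Tc_rhs /fps_shift; congr (_ * _).
apply: fps_mul_local => i le_in; last by [].
by apply: fps_exp_local => j le_ji; apply: eA; rewrite ltnS (leq_trans le_ji).
Qed.

Lemma is_Tc_unique (A B : fps {poly rat}) :
  is_Tc A -> is_Tc B -> forall n, A n = B n.
Proof.
move=> [_ hA] [_ hB] n; have [m] := ubnP n.
elim: m n => [n|m IHm n lt_nm]; first by rewrite ltn0.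
rewrite hA hB; apply: Tc_rhs_local => i lt_in; apply: IHm.
exact: leq_trans lt_in lt_nm.
Qed.

Lemma is_Tc_exists : exists A, is_Tc A.
Proof.
pose A0 : fps {poly rat} := fun=> 0.
have stab m k n : (n < m)%N -> (n < k)%N ->
    iter m Tc_rhs A0 n = iter k Tc_rhs A0 n.
  elim: m k n => [k n|m IHm [|k] n lt_nm lt_nk]; rewrite ?ltn0 ?iterS //.
  apply: Tc_rhs_local => i lt_in; apply: IHm; exact: leq_trans lt_in _.
exists (fun n => iter n.+1 Tc_rhs A0 n); split=> [|n]; first by rewrite iterS.
rewrite iterS; apply: Tc_rhs_local => i lt_in; exact: stab.
Qed.

(* t_T(u) *)
Definition tpoly (n : nat) (T : ptree n) : {poly rat} :=
  (#|Aut_pmap (rep T)|%:R)^-1 *: \sum_(s in Aut_pmap (rep T)) 'X^(fixn s).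

(* Main.v *)
(** Divided by n!, the number of pairs (p, s) with p a labelled forest on n nodes
    and s an automorphism of p, weighted by u^(s_1), is the sum over the forests
    F of size n of the averages of u^(s_1) over Aut F (orbit-stabilizer), and
    likewise for trees.  Call these series G(z,u) and t(z,u).  Removing the root,
    which every automorphism fixes, gives t = z u G.  Splitting off the components
    whose root is fixed by s gives G = exp(t) H, where H counts the pairs such
    that s fixes no root, that is, no node: so H does not depend on u.  At u = 1,
    t is T(z) and G counts the multisets of Polya trees, so that
    G = exp(T(z) + T(z^2)/2 + ...) = exp(T) D.  Cancelling exp(T) gives H = D,
    which is the first claim, and t = z u exp(t) D is then the second one.  The
    third claim is Burnside's lemma for Aut T acting on the nodes of T. *)
From HB Require Import structures.
Require Import Defs.
From mathcomp Require Import all_boot all_order all_algebra all_fingroup.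
(* Again, since seq.pmap shadows the parent maps. *)
Import Defs.

Set Implicit Arguments.
Unset Strict Implicit.
Unset Printing Implicit Defensive.

Import GRing.Theory Num.Theory.
Local Open Scope ring_scope.

(** * Formal power series *)

Section FormalPowerSeries.
Variable R : comUnitRingType.
Implicit Types A B C : fps R.

(** Low coefficients of a Cauchy product are those of a product of polynomials, so commutativity and
    associativity are inherited from [{poly R}]. *)
Definition fps_trunc N A : {poly R} := \poly_(i < N.+1) A i.

Lemma fps_mulE N A B n : (n <= N)%N ->
  fps_mul A B n = (fps_trunc N A * fps_trunc N B)`_n.
Proof.
move=> le_nN; rewrite coefM; apply: eq_bigr => i _; rewrite !coef_poly.
by rewrite !ltnS (leq_trans (leq_ord i) le_nN) (leq_trans (leq_subr _ _) le_nN).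
Qed.

Lemma fps_mulC A B n : fps_mul A B n = fps_mul B A n.
Proof. by rewrite !(@fps_mulE n) // mulrC. Qed.

Lemma fps_mulA A B C n :
  fps_mul A (fps_mul B C) n = fps_mul (fps_mul A B) C n.
Proof.
have trunc_mul X Y m : (m <= n)%N ->
    fps_mul X Y m = (fps_trunc n X * fps_trunc n Y)`_m by exact: fps_mulE.
transitivity ((fps_trunc n A * (fps_trunc n B * fps_trunc n C))`_n).
  rewrite coefM; apply: eq_bigr => i _.
  by rewrite trunc_mul ?leq_subr // coef_poly ltn_ord.
rewrite mulrA coefM; apply: eq_bigr => i _.
by rewrite trunc_mul ?leq_ord // coef_poly ltnS leq_subr.
Qed.

Lemma fps_mulZl a A B n : fps_mul (fun m => a * A m) B n = a * fps_mul A B n.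
Proof. by rewrite /fps_mul mulr_sumr; apply: eq_bigr => i _; rewrite mulrA. Qed.

Lemma fps_mulDl A B C n :
  fps_mul (fun m => A m + B m) C n = fps_mul A C n + fps_mul B C n.
Proof. by rewrite /fps_mul -big_split; apply: eq_bigr => i _; rewrite mulrDl. Qed.

Lemma fps_mul_suml (I : finType) (F : I -> fps R) B n :
  fps_mul (fun m => \sum_i F i m) B n = \sum_i fps_mul (F i) B n.
Proof.
rewrite /fps_mul exchange_big; apply: eq_bigr => i _ /=.
by rewrite mulr_suml.
Qed.

Lemma fps_mul1l A n : fps_mul (@fps_one R) A n = A n.
Proof.
rewrite /fps_mul big_ord_recl /fps_one mul1r subn0 big1 ?addr0 // => i _.
by rewrite mul0r.
Qed.

Lemma fps_pow_eq0 A k n : A 0%N = 0 -> (n < k)%N -> fps_pow A k n = 0.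
Proof.
move=> A0; elim: k n => // k IHk n lt_nk; apply: big1 => -[[|i] lti] _ /=.
  by rewrite A0 mul0r.
rewrite [X in _ * X](_ : _ = 0) ?mulr0 //; apply: IHk.
by rewrite ltn_subLR // addSn (leq_trans lt_nk) // ltnS leq_addl.
Qed.

(** Powers beyond the degree vanish, so one summation bound [N] can serve all the coefficients that
    enter a product. *)
Lemma fps_exp_wide A N n : A 0%N = 0 -> (n <= N)%N ->
  fps_exp A n = \sum_(k < N.+1) (k`!%:R)^-1 * fps_pow A k n.
Proof.
move=> A0 le_nN; rewrite /fps_exp.
rewrite -!(big_mkord xpredT (fun k => (k`!%:R)^-1 * fps_pow A k n)).
rewrite [RHS](big_cat_nat _ (n := n.+1)) //= [X in _ + X]big_nat_cond.
rewrite [X in _ + X]big1 ?addr0 // => k /andP[/andP[lt_nk _] _].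
by rewrite fps_pow_eq0 ?mulr0.
Qed.

Lemma fps_exp0 A : A 0%N = 0 -> fps_exp A 0 = 1.
Proof.
by move=> A0; rewrite /fps_exp big_ord1 /= /fps_one invr1 mul1r.
Qed.

(** The operator z d/dz: a derivation that keeps degrees. *)
Definition euler A : fps R := fun n => n%:R * A n.

Lemma eulerM A B n :
  euler (fps_mul A B) n = fps_mul (euler A) B n + fps_mul A (euler B) n.
Proof.
rewrite /euler /fps_mul mulr_sumr -big_split; apply: eq_bigr => i _ /=.
rewrite -{1}(subnKC (leq_ord i)) natrD mulrDl !mulrA; congr (_ + _).
by rewrite [_ * A i]mulrC.
Qed.

Lemma euler_pow A k n :
  euler (fps_pow A k.+1) n = k.+1%:R * fps_mul (euler A) (fps_pow A k) n.
Proof.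
elim: k n => [|k IHk] n; rewrite /fps_pow iterS -/(fps_pow _ _) eulerM.
  rewrite mul1r [X in _ + X]big1 ?addr0 // => i _.
  by rewrite /euler /fps_one; case: (n - i)%N => [|m]; rewrite ?mul0r ?mulr0.
rewrite [in RHS]mulrS mulrDl mul1r; congr (_ + _).
transitivity
  (fps_mul A (fun m => k.+1%:R * fps_mul (euler A) (fps_pow A k) m) n).
  by apply: fps_mul_local => // i _; rewrite IHk.
rewrite fps_mulC fps_mulZl; congr (_ * _); rewrite fps_mulC !fps_mulA.
by apply: fps_mul_local => // i _; rewrite fps_mulC.
Qed.

Hypothesis natr_unit : forall n, (n.+1%:R : R) \is a GRing.unit.

Lemma fact_unit n : (n`!%:R : R) \is a GRing.unit.
Proof. by rewrite -(prednK (fact_gt0 n)). Qed.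

Lemma euler_exp A n : A 0%N = 0 ->
  euler (fps_exp A) n = fps_mul (euler A) (fps_exp A) n.
Proof.
(* The bound is raised by one, so that [n.+1] terms remain after the constant term k = 0 is
   removed. *)
move=> A0; rewrite /euler (fps_exp_wide A0 (leqnSn n)) mulr_sumr big_ord_recl.
rewrite [X in X + _](_ : _ = 0) ?add0r; last first.
  by rewrite /= /fps_one; case: n => [|n]; rewrite ?mul0r ?mulr0.
transitivity (fps_mul (euler A)
    (fun m => \sum_(k < n.+1) (k`!%:R)^-1 * fps_pow A k m) n).
  rewrite fps_mulC fps_mul_suml; apply: eq_bigr => i _.
  rewrite lift0 fps_mulZl [in RHS]fps_mulC mulrCA.
  rewrite (euler_pow A i n : n%:R * fps_pow A i.+1 n = _) mulrA.
  congr (_ * _); rewrite factS natrM invrM ?fact_unit //.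
  by rewrite -mulrA mulVr ?mulr1.
by apply: fps_mul_local => // i le_in; rewrite (fps_exp_wide A0 le_in).
Qed.

(** The n-th coefficient of the product is [B n] plus terms in earlier coefficients of [B], on which
    induction applies. *)
Lemma fps_mulI A B C : A 0%N = 1 ->
  (forall n, fps_mul A B n = fps_mul A C n) -> forall n, B n = C n.
Proof.
move=> A0 eqAB n; have [m] := ubnP n; elim: m n => // m IHm n lt_nm.
have:= eqAB n; rewrite /fps_mul !big_ord_recl /= A0 !mul1r subn0.
rewrite [X in _ + X = _](eq_bigr
  (fun i : 'I_n => A (bump 0 i) * C (n - bump 0 i)%N)).
  exact: addIr.
move=> i _; rewrite IHm // (leq_trans _ (lt_nm : (n <= m)%N)) //.
by rewrite /bump add1n subnSK // leq_subr.
Qed.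

End FormalPowerSeries.

Lemma natr_unit_rat n : (n.+1%:R : rat) \is a GRing.unit.
Proof. by rewrite unitfE pnatr_eq0. Qed.

Lemma natr_unit_poly n : (n.+1%:R : {poly rat}) \is a GRing.unit.
Proof. by rewrite poly_unitE -polyC_natr size_polyC coefC pnatr_eq0 natr_unit_rat. Qed.

(** * Parent maps and their automorphisms *)

Section ParentMaps.
Implicit Types V W : finType.

(** A root is its own image, so the iterates become constant once a root is reached. *)
Definition up V (p : pmap V) (v : V) : V := odflt v (p v).

Definition rt V (p : pmap V) (v : V) : V := iter #|V| (up p) v.

Definition hom V W (p : pmap V) (q : pmap W) (f : V -> W) : Prop :=
  forall v, q (f v) = omap f (p v).

Lemma morphP V (p q : pmap V) (s : {perm V}) :
  reflect (hom p q s) (morph p q s).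
Proof. by apply: (iffP forallP) => h v; have /eqP := h v. Qed.

Section Roots.
Variables (V : finType) (p : pmap V).

Lemma iter_up_root v k : p v = None -> iter k (up p) v = v.
Proof. by move=> pv; elim: k => //= k ->; rewrite /up pv. Qed.

Lemma iter_up_stable v k m : p (iter k (up p) v) = None -> (k <= m)%N ->
  iter m (up p) v = iter k (up p) v.
Proof. by move=> pk /subnK <-; rewrite iterD iter_up_root. Qed.

Lemma connect_iter_up v k : connect (parent_rel p) v (iter k (up p) v).
Proof.
elim: k => [|k IHk] /=; first exact: connect0.
apply: (connect_trans IHk); set w := iter _ _ _; rewrite /up.
by case pw: (p w) => [x|] /=; [apply: connect1; apply/eqP | apply: connect0].
Qed.

(** The path can be made free of repetitions, which bounds its length; this is why [#|V|] iterations
    suffice in [rt]. *)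
Lemma connect_upP v r : connect (parent_rel p) v r ->
  exists2 k, (k <= #|V|)%N & r = iter k (up p) v.
Proof.
case/connectP=> s0 ps0 ->; case/shortenP: ps0 => s ps us _.
exists (size s).
  by apply: ltnW; have := max_card [in v :: s]; rewrite (card_uniqP us).
elim: s v ps {us s0} => //= w s IHs v /andP[/eqP pv ps].
by rewrite IHs // -iterS iterSr /up pv.
Qed.

Lemma rforestP :
  reflect (forall v, exists k, p (iter k (up p) v) = None) (rforest p).
Proof.
apply: (iffP forallP) => pf v.
  have /existsP[r /andP[/eqP pr /connect_upP[k _ rE]]] := pf v.
  by exists k; rewrite -rE.
have [k pk] := pf v; apply/existsP; exists (iter k (up p) v).
by rewrite pk eqxx connect_iter_up.
Qed.

Hypothesis pf : rforest p.

Lemma rt_root v : p (rt p v) = None.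
Proof.
have /forallP/(_ v)/existsP[r /andP[/eqP pr /connect_upP[k lek rE]]] := pf.
by rewrite /rt (iter_up_stable _ lek) -rE.
Qed.

Lemma rtE v k : p (iter k (up p) v) = None -> rt p v = iter k (up p) v.
Proof.
move=> pk; have [lek|/ltnW lek] := leqP k #|V|; first exact: iter_up_stable.
by rewrite (iter_up_stable (rt_root v) lek).
Qed.

Lemma rt_id r : p r = None -> rt p r = r.
Proof. by move=> pr; rewrite (@rtE r 0%N). Qed.

Lemma rt_up v w : p v = Some w -> rt p w = rt p v.
Proof.
move=> pv; have wE : w = up p v by rewrite /up pv.
rewrite [RHS](@rtE v #|V|.+1) /=; first by rewrite -iterS iterSr -wE.
by rewrite -iterS iterSr -wE; exact: rt_root.
Qed.

End Roots.

Section Homs.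
Variables (V W : finType) (p : pmap V) (q : pmap W) (f : V -> W).
Hypothesis pqf : hom p q f.

Lemma hom_iter_up v k : iter k (up q) (f v) = f (iter k (up p) v).
Proof. by elim: k => //= k ->; rewrite /up pqf; case: (p _). Qed.

Lemma hom_root v : (q (f v) == None) = (p v == None).
Proof. by rewrite pqf; case: (p v). Qed.

Lemma hom_rforest : rforest q -> rforest p.
Proof.
move/rforestP=> qf; apply/rforestP=> v; have [k] := qf (f v); exists k.
by apply/eqP; rewrite -hom_root -hom_iter_up; apply/eqP.
Qed.

Lemma hom_rt v : rforest q -> rt q (f v) = f (rt p v).
Proof.
move=> qf; have pf := hom_rforest qf.
rewrite (@rtE _ _ qf _ #|V|) hom_iter_up //.
by apply/eqP; rewrite hom_root; apply/eqP; apply: rt_root.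
Qed.

Lemma hom_rforest_onto : (forall w, exists v, w = f v) -> rforest p -> rforest q.
Proof.
move=> f_onto /rforestP pf; apply/rforestP=> w; have [v ->] := f_onto w.
have [k pk] := pf v; exists k.
by apply/eqP; rewrite hom_iter_up hom_root; apply/eqP.
Qed.

End Homs.

Lemma rtreeP V (p : pmap V) :
  reflect (rforest p /\ exists r, forall v, (p v == None) = (v == r)) (rtree p).
Proof.
apply: (iffP andP) => -[pf].
  move/cards1P=> [r rE]; split=> //; exists r => v.
  by move/setP/(_ v): rE; rewrite !inE.
by case=> r rE; split=> //; apply/cards1P; exists r; apply/setP=> v; rewrite !inE.
Qed.

Definition comp V (p : pmap V) (r : V) : {set V} := [set v | rt p v == r].

(** Counting pairs of a structure and one of its automorphisms replaces averaging over automorphism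
    groups. *)
Definition pst V : Type := (pmap V * {perm V})%type.

HB.instance Definition _ V := Finite.on (pst V).

Definition faut V (x : pst V) : bool := rforest x.1 && morph x.1 x.1 x.2.

Definition taut V (x : pst V) : bool := rtree x.1 && morph x.1 x.1 x.2.

Definition froots V (x : pst V) : {set V} :=
  [set r | (x.1 r == None) && (x.2 r == r)].

(** For an automorphism these are the components mapped to themselves, the ones that the exponential
    formula splits off. *)
Definition comps V (x : pst V) : {set {set V}} :=
  [set comp x.1 r | r in froots x].

Lemma card_comps V (x : pst V) : faut x -> #|comps x| = #|froots x|.
Proof.
case/andP=> xf _; apply: card_in_imset => r r'; rewrite !inE.
move=> /andP[/eqP xr _] /andP[/eqP xr' _] /setP/(_ r).
by rewrite !inE !(rt_id xf) // eqxx => /esym/eqP.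
Qed.

Lemma taut_faut V (x : pst V) : taut x = faut x && (#|[set r | x.1 r == None]| == 1)%N.
Proof. by rewrite /taut /faut /rtree andbAC. Qed.

(** An automorphism sends roots to roots, so it fixes the root when there is only one. *)
Lemma taut_froots V (x : pst V) : taut x ->
  exists r, forall v, (x.1 v == None) = (v == r) /\ froots x = [set r].
Proof.
case/andP=> /rtreeP[xf [r rE]] /morphP xm; exists r => v; split=> //.
apply/setP=> w; rewrite !inE rE andb_idr // => /eqP ->.
by rewrite -rE (hom_root xm) rE.
Qed.

(* Nodes fixed by an automorphism have their root fixed. *)
Lemma fixn_eq0 V (x : pst V) : faut x -> (fixn x.2 == 0)%N = (#|froots x| == 0)%N.
Proof.
case/andP=> xf /morphP xm; rewrite /fixn !cards_eq0; apply/eqP/eqP=> [x0|x0].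
  apply/setP=> r; rewrite !inE; move/setP/(_ r): x0; rewrite !inE => ->.
  by rewrite andbF.
apply/setP=> v; rewrite !inE; apply/negP=> /eqP xv.
have /negP[] : rt x.1 v \notin froots x by rewrite x0 inE.
by rewrite inE -(hom_rt xm) // xv rt_root // !eqxx.
Qed.

End ParentMaps.

(** * Transport of structure along a bijection of node sets *)

Section Transport.
Variables (V W : finType) (f : V -> W) (g : W -> V).
Hypotheses (fK : cancel f g) (gK : cancel g f).

Definition pmap_tr (p : pmap V) : pmap W := [ffun w => omap f (p (g w))].

Lemma perm_tr_inj (s : {perm V}) : injective (fun w => f (s (g w))).
Proof. by move=> w w' /(can_inj fK)/perm_inj/(can_inj gK). Qed.

Definition perm_tr (s : {perm V}) : {perm W} := perm (@perm_tr_inj s).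

Definition pst_tr (x : pst V) : pst W := (pmap_tr x.1, perm_tr x.2).

Lemma pmap_tr_hom p : hom p (pmap_tr p) f.
Proof. by move=> v; rewrite ffunE fK. Qed.

Lemma perm_trE s v : perm_tr s (f v) = f (s v).
Proof. by rewrite permE fK. Qed.

Lemma tr_onto w : exists v, w = f v.
Proof. by exists (g w); rewrite gK. Qed.

Lemma pmap_tr_morph p s :
  morph (pmap_tr p) (pmap_tr p) (perm_tr s) = morph p p s.
Proof.
have trh := @pmap_tr_hom p; apply/morphP/morphP=> [h v | h w].
  have := h (f v); rewrite perm_trE !trh; case: (p _) (p _) => [a|] [b|] //=.
  by rewrite perm_trE => -[/(can_inj fK) ->].
have [v ->] := tr_onto w; rewrite perm_trE !trh h.
by case: (p v) => //= a; rewrite perm_trE.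
Qed.

Lemma pst_tr_faut x : faut (pst_tr x) = faut x.
Proof.
have trh := @pmap_tr_hom x.1; rewrite /faut pmap_tr_morph; congr (_ && _).
by apply/idP/idP; [apply: hom_rforest trh | apply: hom_rforest_onto trh tr_onto].
Qed.

Lemma pst_tr_roots x :
  [set r | (pst_tr x).1 r == None] = f @: [set r | x.1 r == None].
Proof.
apply/setP=> w; have [v ->] := tr_onto w.
by rewrite (mem_imset _ _ (can_inj fK)) !inE (hom_root (@pmap_tr_hom _)).
Qed.

Lemma pst_tr_froots x : froots (pst_tr x) = f @: froots x.
Proof.
apply/setP=> w; have [v ->] := tr_onto w; rewrite (mem_imset _ _ (can_inj fK)).
by rewrite !inE (hom_root (@pmap_tr_hom _)) perm_trE (inj_eq (can_inj fK)).
Qed.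

Lemma pst_tr_taut x : taut (pst_tr x) = taut x.
Proof.
by rewrite !taut_faut pst_tr_faut pst_tr_roots (card_imset _ (can_inj fK)).
Qed.

Lemma fixn_tr s : fixn (perm_tr s) = fixn s.
Proof.
rewrite /fixn -(card_imset [set v | s v == v] (can_inj fK)); congr #|pred_of_set _|.
apply/setP=> w; have [v ->] := tr_onto w; rewrite (mem_imset _ _ (can_inj fK)).
by rewrite !inE perm_trE (inj_eq (can_inj fK)).
Qed.

Lemma pst_tr_comps x : rforest x.1 ->
  comps (pst_tr x) = [set f @: (S : {set V}) | S in comps x].
Proof.
move=> xf; rewrite /comps pst_tr_froots -!imset_comp; apply: eq_in_imset => r _ /=.
have trf : rforest (pmap_tr x.1) by exact: (hom_rforest_onto (@pmap_tr_hom _) tr_onto).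
apply/setP=> w; have [v ->] := tr_onto w; rewrite (mem_imset _ _ (can_inj fK)).
by rewrite !inE (hom_rt (@pmap_tr_hom _)) // (inj_eq (can_inj fK)).
Qed.

End Transport.

Lemma pst_trK (V W : finType) (f : V -> W) (g : W -> V) 
  (fK : cancel f g) (gK : cancel g f) : cancel (pst_tr fK gK) (pst_tr gK fK).
Proof.
case=> p s; congr (_, _); first apply/ffunP=> v; last apply/permP=> v.
  by rewrite !ffunE fK; case: (p v) => //= w; rewrite fK.
by rewrite !permE !fK.
Qed.

Lemma card_eq_can (V W : finType) : #|V| = #|W| ->
  exists f : V -> W, exists g : W -> V, cancel f g /\ cancel g f.
Proof.
move=> VW; exists (fun v => enum_val (cast_ord VW (enum_rank v))).
exists (fun w => enum_val (cast_ord (esym VW) (enum_rank w))).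
by split=> v; rewrite enum_valK ?cast_ordK ?cast_ordKV enum_rankK.
Qed.

(** * Gluing and grafting *)

Section Glue.
Variables A B : finType.

Definition pmap_sum (p : pmap A) (q : pmap B) : pmap (A + B)%type :=
  [ffun x => match x with inl a => omap inl (p a) | inr b => omap inr (q b) end].

Definition sum_fun (s : A -> A) (t : B -> B) (x : A + B) : A + B :=
  match x with inl a => inl (s a) | inr b => inr (t b) end.

Lemma sum_fun_inj (s : {perm A}) (t : {perm B}) : injective (sum_fun s t).
Proof. by move=> [a|b] [a'|b'] //= [] /perm_inj ->. Qed.

Definition glue (z : pst A * pst B) : pst (A + B)%type :=
  (pmap_sum z.1.1 z.2.1, perm (@sum_fun_inj z.1.2 z.2.2)).

Lemma glue_inj : injective glue.
Proof.
case=> [[p s] [q t]] [[p' s'] [q' t']] [/ffunP pq /permP st].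
congr (_, _, (_, _)).
- apply/ffunP=> a; have := pq (inl a); rewrite !ffunE /=.
  by case: (p a) (p' a) => [x|] [y|] //= [->].
- by apply/permP=> a; have := st (inl a); rewrite !permE => -[].
- apply/ffunP=> b; have := pq (inr b); rewrite !ffunE /=.
  by case: (q b) (q' b) => [x|] [y|] //= [->].
by apply/permP=> b; have := st (inr b); rewrite !permE => -[].
Qed.

Lemma pmap_sum_homl p q : hom p (pmap_sum p q) inl.
Proof. by move=> a; rewrite ffunE. Qed.

Lemma pmap_sum_homr p q : hom q (pmap_sum p q) inr.
Proof. by move=> b; rewrite ffunE. Qed.

Lemma glue_faut x y : faut (glue (x, y)) = faut x && faut y.
Proof.
have hl := @pmap_sum_homl x.1 y.1; have hr := @pmap_sum_homr x.1 y.1.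
apply/idP/idP=> [/andP[zf /morphP zm] |
                 /andP[/andP[xf /morphP xm] /andP[yf /morphP ym]]].
  apply/andP; split; apply/andP; split.
  - exact: hom_rforest hl zf.
  - apply/morphP=> a; have := zm (inl a); rewrite !permE !ffunE /=.
    by case: (x.1 _) (x.1 _) => [?|] [?|] //=; rewrite permE => -[->].
  - exact: hom_rforest hr zf.
  - apply/morphP=> a; have := zm (inr a); rewrite !permE !ffunE /=.
    by case: (y.1 _) (y.1 _) => [?|] [?|] //=; rewrite permE => -[->].
apply/andP; split; last first.
  apply/morphP=> -[a|b]; rewrite !permE !ffunE /= ?xm ?ym.
    by case: (x.1 a) => //= c; rewrite permE.
  by case: (y.1 b) => //= c; rewrite permE.
apply/rforestP=> -[a|b].
  have [k ka] := elimT (rforestP _) xf a; exists k.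
  by apply/eqP; rewrite (hom_iter_up hl) (hom_root hl) ka.
have [k kb] := elimT (rforestP _) yf b; exists k.
by apply/eqP; rewrite (hom_iter_up hr) (hom_root hr) kb.
Qed.

Lemma card_sum_set (P : {set A + B}) :
  #|P| = (#|[set a | inl a \in P]| + #|[set b | inr b \in P]|)%N.
Proof.
rewrite -(card_imset _ (@inl_inj A B)) -(card_imset [set b | _] (@inr_inj A B)).
rewrite -cardsUI [X in (_ + #|pred_of_set X|)%N](_ : _ = set0) ?cards0 ?addn0.
  apply: eq_card => -[c|c]; rewrite inE; apply/idP/orP.
  - by move=> cP; left; apply: imset_f; rewrite inE.
  - by case=> /imsetP[d]; rewrite ?inE // => dP [->].
  - by move=> cP; right; apply: imset_f; rewrite inE.
  - by case=> /imsetP[d]; rewrite ?inE // => dP [->].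
apply/setP=> c; rewrite !inE; apply/negP=> /andP[/imsetP[a _ ->]].
by case/imsetP.
Qed.

Lemma glue_fixn x y : fixn (glue (x, y)).2 = (fixn x.2 + fixn y.2)%N.
Proof.
rewrite /fixn card_sum_set; congr (_ + _)%N; apply: eq_card => a;
by rewrite !inE permE.
Qed.

Lemma glue_card_froots x y :
  #|froots (glue (x, y))| = (#|froots x| + #|froots y|)%N.
Proof.
rewrite card_sum_set; congr (_ + _)%N; apply: eq_card => a;
rewrite !inE permE.
  by rewrite (hom_root (@pmap_sum_homl _ _)).
by rewrite (hom_root (@pmap_sum_homr _ _)).
Qed.

Definition is_left (x : A + B) : bool := if x is inl _ then true else false.

Lemma glue_onto (z : pst (A + B)%type) :
  (forall v, is_left (z.2 v) = is_left v) ->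
  (forall v w, z.1 v = Some w -> is_left w = is_left v) ->
  exists x y, z = glue (x, y).
Proof.
case: z => p s /= sl pl.
(* Since [s] preserves sides, the default branches only serve to make both maps total. *)
pose s1 a := if s (inl a) is inl a' then a' else a.
pose s2 b := if s (inr b) is inr b' then b' else b.
have s1E a : s (inl a) = inl (s1 a).
  by rewrite /s1; have := sl (inl a); case: (s (inl a)).
have s2E b : s (inr b) = inr (s2 b).
  by rewrite /s2; have := sl (inr b); case: (s (inr b)).
have s1I : injective s1.
  by move=> a a' /(congr1 (@inl A B)); rewrite -!s1E => /perm_inj[].
have s2I : injective s2.
  by move=> b b' /(congr1 (@inr A B)); rewrite -!s2E => /perm_inj[].
pose p1 : pmap A := [ffun a => if p (inl a) is Some (inl a') then Some a' else None].
pose p2 : pmap B := [ffun b => if p (inr b) is Some (inr b') then Some b' else None].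
exists (p1, perm s1I), (p2, perm s2I); congr (_, _).
  apply/ffunP=> -[a|b]; rewrite !ffunE /=.
    by case pa: (p (inl a)) => [[a'|b']|] //; have := pl _ _ pa.
  by case pb: (p (inr b)) => [[a'|b']|] //; have := pl _ _ pb.
by apply/permP=> -[a|b]; rewrite permE /= permE ?s1E ?s2E.
Qed.

Definition left_set : {set A + B} := [set v | is_left v].

(** No edge joins the two summands, so the left one is a single component exactly when it is a tree;
    its root is then fixed by [taut_froots]. *)
Lemma glue_left_comp x y :
  [&& faut (glue (x, y)) & left_set \in comps (glue (x, y))] = taut x && faut y.
Proof.
have hl := @pmap_sum_homl x.1 y.1; have hr := @pmap_sum_homr x.1 y.1.
apply/andP/andP=> [[zf]|[xt yf]].
  have := zf; rewrite glue_faut => /andP[xf ->].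
  case/imsetP=> r /[!inE] /andP[zr _] /setP lr; split=> //.
  have pf := proj1 (andP zf).
  (* The root [r] belongs to its own component, hence it is a left node. *)
  rewrite taut_faut xf /=; have := lr r; rewrite !inE.
  rewrite (rt_id pf) ?eqxx; last exact/eqP.
  case: r zr lr => // r zr lr _.
  apply/cards1P; exists r; apply/setP=> v; rewrite !inE; apply/eqP/eqP=> [xv|->].
    have := lr (inl v); rewrite !inE /= => /esym/eqP; rewrite rt_id //; first by case.
    by apply/eqP; rewrite (hom_root hl) xv.
  by apply/eqP; rewrite -(hom_root hl).
have [r rP] := taut_froots xt.
have xf : faut x by move: xt; rewrite taut_faut => /andP[].
have zf : faut (glue (x, y)) by rewrite glue_faut xf.
have pf := proj1 (andP zf).
split=> //; apply/imsetP; exists (inl r).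
  have : r \in froots x by case: (rP r) => _ ->; rewrite inE.
  by rewrite !inE permE (hom_root hl).
apply/setP=> -[a|b]; rewrite !inE /=.
  rewrite (hom_rt hl) //; apply/esym/eqP; congr inl; apply/eqP.
  by case: (rP (rt x.1 a)) => <- _; rewrite rt_root //; case/andP: xf.
by rewrite (hom_rt hr).
Qed.

(** The component of a fixed root is preserved by the parent map and by the automorphism, so
    [glue_onto] applies. *)
Lemma left_comp_glue (z : pst (A + B)%type) :
  faut z -> left_set \in comps z -> exists x y, z = glue (x, y).
Proof.
move=> /andP[zf /morphP zm] /imsetP[r /[!inE] /andP[_ /eqP zr] /setP lr].
have lE v : is_left v = (rt z.1 v == r) by have := lr v; rewrite !inE.
apply: glue_onto => v; first by rewrite !lE (hom_rt zm) // -{1}zr (inj_eq perm_inj).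
by move=> w /(rt_up zf); rewrite !lE => ->.
Qed.

End Glue.

(** * Adding a root to a forest *)

Section GraftRoot.
Variable W : finType.

Definition omap_inj (s : {perm W}) : injective (omap s).
Proof. by move=> [v|] [w|] //= [/perm_inj ->]. Qed.

(* The node None is a new root, to which the roots of y are attached. *)
Definition graft (y : pst W) : pst (option W) :=
  ([ffun v => omap (fun w => y.1 w) v], perm (@omap_inj y.2)).

Lemma graft_inj : injective graft.
Proof.
case=> [p s] [q t] [/ffunP pq /permP st]; congr (_, _).
  by apply/ffunP=> w; have := pq (Some w); rewrite !ffunE /= => -[].
by apply/permP=> w; have := st (Some w); rewrite !permE /= => -[].
Qed.

Lemma graft_fixn y : fixn (graft y).2 = (fixn y.2).+1.
Proof.
rewrite /fixn (cardsD1 None) inE permE /= add1n; congr _.+1.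
rewrite -(card_imset [set w | y.2 w == w] (@Some_inj _)).
apply: eq_card => -[w|]; rewrite !inE ?permE.
  by rewrite (mem_imset _ _ (@Some_inj _)) !inE.
by apply/esym/negP=> /imsetP[].
Qed.

Lemma graft_root y v : ((graft y).1 v == None) = (v == None).
Proof. by rewrite ffunE; case: v. Qed.

Lemma graft_taut y : taut (graft y) = faut y.
Proof.
have mE : morph (graft y).1 (graft y).1 (graft y).2 = morph y.1 y.1 y.2.
  apply/morphP/morphP=> h.
    move=> w; have := h (Some w); rewrite !ffunE /= !permE /= => -[->].
    by case: (y.1 w) => //= a; rewrite permE.
  move=> [w|]; last by rewrite permE !ffunE.
  by rewrite permE !ffunE /= permE h.
have upE w : up (graft y).1 (Some w) = y.1 w by rewrite /up ffunE.
rewrite /taut /faut mE; congr (_ && _); apply/idP/idP=> [/rtreeP[/rforestP gf _]|].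
  apply/rforestP=> w; have [k] := gf (Some w).
  elim: k w => [|k IHk] w; first by rewrite ffunE.
  case yw: (y.1 w) => [w'|] gk; last by exists 0%N.
  have [|m mP] := IHk w'; first by move: gk; rewrite iterSr upE yw.
  by exists m.+1; rewrite iterSr /up yw.
move=> /rforestP yf; apply/rtreeP; split; last first.
  by exists None => v; rewrite graft_root.
apply/rforestP=> -[w|]; last by exists 0%N; rewrite /= ffunE.
have [k] := yf w; elim: k w => [|k IHk] w.
  by move=> /= yw; exists 1%N; rewrite /= upE yw ffunE.
case yw: (y.1 w) => [w'|] h; last by exists 1%N; rewrite /= upE yw ffunE.
have [|m mP] := IHk w'; first by move: h; rewrite iterSr /up yw.
by exists m.+1; rewrite iterSr upE yw.
Qed.

Lemma graft_onto (x : pst (option W)) :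
  taut x -> x.1 None = None -> exists y, x = graft y.
Proof.
case: x => p s; rewrite /taut /= => /andP[/rtreeP[pf [r rE]] /morphP pm] pN.
have rN : r = None by apply/esym/eqP; rewrite -rE pN.
have sN : s None = None.
  by apply/eqP; rewrite -rN -rE (hom_root pm) rN pN.
pose s1 w := odflt w (s (Some w)).
have s1E w : s (Some w) = Some (s1 w).
  rewrite /s1; case sw: (s (Some w)) => [//|].
  by have /perm_inj := etrans sw (esym sN).
have s1I : injective s1.
  by move=> a b ab; apply/Some_inj/(@perm_inj _ s); rewrite !s1E ab.
(* As [None] is the only root, [p (Some w)] is always some parent; stripping one [option] turns the
   children of [None] into roots. *)
exists ([ffun w => odflt None (p (Some w))], perm s1I); congr (_, _).
  apply/ffunP=> -[w|]; rewrite ffunE //= ffunE.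
  by case pw: (p (Some w)) => //; have := rE (Some w); rewrite pw rN eqxx.
by apply/permP=> -[w|]; rewrite permE //= permE.
Qed.

End GraftRoot.

(** * Labelled enumeration *)

Section Counting.
Variables (R : comUnitRingType) (u : R).

Definition forest_sum (V : finType) (k : nat) : R :=
  \sum_(x : pst V | faut x && (#|froots x| == k)) u ^+ fixn x.2.

Definition tree_sum (V : finType) : R :=
  \sum_(x : pst V | taut x) u ^+ fixn x.2.

Lemma sum_pst_tr (V W : finType) (f : V -> W) (g : W -> V)
    (fK : cancel f g) (gK : cancel g f) (P : pred (pst W)) (F : pst W -> R) :
  \sum_(y | P y) F y = \sum_(x | P (pst_tr fK gK x)) F (pst_tr fK gK x).
Proof.
apply: reindex; exists (pst_tr gK fK) => x _; exact: pst_trK.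
Qed.

Lemma forest_sum_card (V W : finType) k : #|V| = #|W| ->
  forest_sum V k = forest_sum W k.
Proof.
case/card_eq_can=> f [g [fK gK]].
rewrite /forest_sum (sum_pst_tr gK fK); apply: eq_big => x; last by rewrite fixn_tr.
by rewrite pst_tr_faut pst_tr_froots card_imset //; apply: can_inj gK.
Qed.

Lemma tree_sum_card (V W : finType) : #|V| = #|W| -> tree_sum V = tree_sum W.
Proof.
case/card_eq_can=> f [g [fK gK]].
rewrite /tree_sum (sum_pst_tr gK fK).
by apply: eq_big => x; rewrite ?pst_tr_taut ?fixn_tr.
Qed.

(** Gluing is a bijection onto these structures, and fixed points add up. The tree accounts for
    exactly one fixed root, whence [k.+1] against [k]. *)
Lemma glue_sum (A B : finType) k :
  \sum_(z : pst (A + B)%type | [&& faut z, #|froots z| == k.+1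
                                 & left_set A B \in comps z]) u ^+ fixn z.2
  = tree_sum A * forest_sum B k.
Proof.
pose Z := [set z : pst A * pst B | taut z.1 & faut z.2 && (#|froots z.2| == k)].
rewrite /tree_sum /forest_sum big_distrlr /= pair_big /=.
transitivity (\sum_(z in @glue A B @: Z) u ^+ fixn z.2); last first.
  rewrite big_imset => [|z z' _ _]; last exact: glue_inj.
  apply: eq_big => [z|[x y] _]; first by rewrite inE.
  by rewrite glue_fixn exprD.
have card1 x : taut x -> #|@froots A x| = 1%N.
  by move=> /taut_froots[r /(_ r)[_ ->]]; rewrite cards1.
apply: eq_bigl => z; apply/and3P/imsetP=> [[zf zk zl] |
  [[x y] /[!inE] /and3P[/= xt yf yk] ->]].
  have [x [y zE]] := left_comp_glue zf zl; exists (x, y) => //; subst z.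
  have /andP[xt yf] : taut x && faut y by rewrite -glue_left_comp zf.
  by rewrite inE xt yf /=; move: zk; rewrite glue_card_froots card1.
have /andP[-> ->] : [&& faut (glue (x, y)) & left_set A B \in comps (glue (x, y))].
  by rewrite glue_left_comp xt.
by rewrite glue_card_froots card1 // (eqP yk).
Qed.

(** This is [glue_sum] transported along the bijection between the disjoint union of [S] and its
    complement and ['I_n]. *)
Lemma forest_sum_comp n k (S : {set 'I_n}) :
  \sum_(z : pst 'I_n | [&& faut z, #|froots z| == k.+1 & S \in comps z])
     u ^+ fixn z.2
  = tree_sum 'I_#|S| * forest_sum 'I_(n - #|S|) k.
Proof.
pose A : finType := {x | x \in S}; pose B : finType := {x | x \notin S}.
pose f (x : A + B) : 'I_n := match x with inl a => val a | inr b => val b end.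
have cA : #|A| = #|S| by rewrite card_sig; apply: eq_card.
have cB : #|B| = (n - #|S|)%N.
  have nE : (#|S| + #|~: S| = n)%N by rewrite cardsC card_ord.
  rewrite card_sig -(congr1 (subn^~ #|S|) nE) addKn.
  by apply: eq_card => i; rewrite !inE.
have fI : injective f.
  move=> [[a aS]|[a aS]] [[b bS]|[b bS]] /= ab.
  - by congr inl; apply: val_inj.
  - by have := bS; rewrite -[X in X \notin _]ab aS.
  - by have := bS; rewrite -[X in X \in _]ab (negPf aS).
  - by congr inr; apply: val_inj.
have [g fK gK] : bijective f.
  apply: (inj_card_bij fI); rewrite card_sum cA cB card_ord subnKC //.
  by have := max_card (mem S); rewrite card_ord.
rewrite (sum_pst_tr fK gK) -(@tree_sum_card A) ?card_ord //.
rewrite -(@forest_sum_card B) ?card_ord // -glue_sum.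
apply: eq_big => z; last by rewrite fixn_tr.
rewrite pst_tr_faut pst_tr_froots card_imset //.
apply: andb_id2l => zf; congr (_ && _); rewrite pst_tr_comps; last by case/andP: zf.
suff -> : S = f @: left_set A B by rewrite mem_imset //; apply: imset_inj.
apply/setP=> i; rewrite -(gK i) mem_imset // inE.
by case: (g i) => [[a aS]|[a aS]] //=; apply/negbTE.
Qed.

(** Double counting of the structures with one of their [k.+1] fixed components marked: by structure
    on the left, by node set of the marked component on the right. *)
Lemma forest_sum_rec n k :
  k.+1%:R * forest_sum 'I_n k.+1
  = \sum_(j < n.+1) 'C(n, j)%:R * (tree_sum 'I_j * forest_sum 'I_(n - j) k).
Proof.
transitivity (\sum_(S : {set 'I_n}) tree_sum 'I_#|S| * forest_sum 'I_(n - #|S|) k).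
  under [RHS]eq_bigr => S _ do rewrite -forest_sum_comp.
  rewrite (exchange_big_dep (fun z => faut z && (#|froots z| == k.+1))) /=.
    rewrite /forest_sum mulr_sumr; apply: eq_bigr => z /andP[zf /eqP zk].
    rewrite (eq_bigl (mem (comps z))) => [|S]; last by rewrite zf zk eqxx.
    by rewrite sumr_const card_comps // zk mulr_natl.
  by move=> S z _ /and3P[-> ->].
(* The sets [S] are grouped by cardinality, which is at most [n], so [inord] loses nothing. *)
rewrite (partition_big (fun S : {set 'I_n} => inord #|S| : 'I_n.+1) xpredT) //=.
apply: eq_bigr => j _.
have cE (S : {set 'I_n}) : (inord #|S| == j) = (#|S| == j).
  rewrite -val_eqE /= inordK // ltnS.
  by have := max_card (mem S); rewrite card_ord.
rewrite (eq_bigr (fun=> tree_sum 'I_j * forest_sum 'I_(n - j) k)); last first.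
  by move=> S; rewrite cE => /eqP ->.
rewrite sumr_const mulr_natl; congr (_ *+ _).
rewrite -[n in 'C(n, _)]card_ord -card_draws; apply: eq_card => S.
by rewrite !inE; apply: cE.
Qed.

(** Exponential generating functions in the number of nodes; in [forest_fps] the index [k] is the
    number of fixed roots. *)
Definition tree_fps : fps R := fun n => tree_sum 'I_n / n`!%:R.
Definition forest_fps k : fps R := fun n => forest_sum 'I_n k / n`!%:R.
Definition all_forest_fps : fps R :=
  fun n => (\sum_(x : pst 'I_n | faut x) u ^+ fixn x.2) / n`!%:R.

Hypothesis natr_unit : forall n, (n.+1%:R : R) \is a GRing.unit.

(** Division by n! turns the binomial convolution of [forest_sum_rec] into a Cauchy product. *)
Lemma forest_fps_rec k n :
  k.+1%:R * forest_fps k.+1 n = fps_mul tree_fps (forest_fps k) n.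
Proof.
rewrite /forest_fps mulrA forest_sum_rec mulr_suml; apply: eq_bigr => j _.
have le_jn : (j <= n)%N by rewrite -ltnS.
rewrite /tree_fps -(bin_fact le_jn) 2!natrM.
have cU : ('C(n, j)%:R : R) \is a GRing.unit.
  by rewrite -(prednK (_ : 0 < 'C(n, j))%N) ?bin_gt0.
have jU := fact_unit natr_unit j; have njU := fact_unit natr_unit (n - j).
have bU : ('C(n, j)%:R * (j`!%:R * (n - j)`!%:R) : R) \is a GRing.unit.
  by rewrite !unitrM cU jU.
apply: (mulIr bU); rewrite mulrVK // (mulrACA (tree_sum _)) [RHS]mulrCA.
congr (_ * _).
by rewrite -mulrA (mulrACA _^-1) !mulVr // !mulr1.
Qed.

Lemma forest_fpsE k n :
  forest_fps k n = (k`!%:R)^-1 * fps_mul (fps_pow tree_fps k) (forest_fps 0) n.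
Proof.
elim: k n => [|k IHk] n; first by rewrite invr1 mul1r fps_mul1l.
have kU := natr_unit k; apply: (mulrI kU); rewrite forest_fps_rec.
rewrite factS natrM invrM ?(fact_unit natr_unit) // [_^-1 * _^-1]mulrC mulrA mulVKr //.
rewrite /fps_pow iterS -fps_mulA.
transitivity (fps_mul tree_fps
    (fun m => k`!%:R^-1 * fps_mul (fps_pow tree_fps k) (forest_fps 0) m) n).
  by apply: fps_mul_local => // i _.
by rewrite fps_mulC fps_mulZl fps_mulC.
Qed.

Lemma tree_fps0 : tree_fps 0 = 0.
Proof.
rewrite /tree_fps /tree_sum big_pred0 ?mul0r // => x; apply/negP.
by move=> /taut_froots[[]].
Qed.

(** The forests are sorted by their number k of fixed roots, each k contributing t^k / k! times the
    series of forests without a fixed root. *)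
Lemma all_forest_fpsE n :
  all_forest_fps n = fps_mul (fps_exp tree_fps) (forest_fps 0) n.
Proof.
transitivity (\sum_(k < n.+1) forest_fps k n).
  rewrite /all_forest_fps /forest_fps -mulr_suml; congr (_ / _).
  rewrite (partition_big (fun x => inord #|froots x| : 'I_n.+1) xpredT) //=.
  apply: eq_bigr => k _; apply: eq_bigl => x; congr (_ && _).
  rewrite -val_eqE /= inordK // ltnS.
  by have := max_card (mem (froots x)); rewrite card_ord.
transitivity (fps_mul (fun m => \sum_(k < n.+1) k`!%:R^-1 * fps_pow tree_fps k m)
                (forest_fps 0) n).
  rewrite fps_mul_suml; apply: eq_bigr => k _.
  by rewrite forest_fpsE fps_mulZl.
by apply: fps_mul_local => // i lei; rewrite (fps_exp_wide tree_fps0 lei).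
Qed.

Lemma graft_sum (W : finType) :
  \sum_(x : pst (option W) | taut x && (x.1 None == None)) u ^+ fixn x.2
  = u * \sum_(y : pst W | faut y) u ^+ fixn y.2.
Proof.
transitivity (\sum_(x in @graft W @: [set y | faut y]) u ^+ fixn x.2).
  apply: eq_bigl => x; apply/andP/imsetP=> [[xt /eqP xN]|[y /[!inE] yf ->]].
    by have [y xE] := graft_onto xt xN; exists y => //; rewrite inE -graft_taut -xE.
  by rewrite graft_taut graft_root.
rewrite big_imset => [|y y' _ _]; last exact: graft_inj.
rewrite mulr_sumr; apply: eq_big => [y|y _]; first by rewrite inE.
by rewrite graft_fixn exprS.
Qed.

(** Each of the [n.+1] labels is the root of trees with the same total weight, obtained by grafting;
    the factor n+1 reduces (n+1)! to n!. *)
Lemma tree_fpsS n : tree_fps n.+1 = u * all_forest_fps n.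
Proof.
have trees_rooted (r : 'I_n.+1) :
    \sum_(x : pst 'I_n.+1 | taut x && (x.1 r == None)) u ^+ fixn x.2
    = u * \sum_(y : pst 'I_n | faut y) u ^+ fixn y.2.
  (* The new root receives the label [r], the other nodes the remaining labels in order. *)
  pose f : option 'I_n -> 'I_n.+1 := oapp (lift r) r.
  have fK : cancel f (unlift r) by case=> [i|]; rewrite /= ?liftK ?unlift_none.
  have gK : cancel (unlift r) f by move=> i; rewrite /f; case: unliftP.
  rewrite -graft_sum (sum_pst_tr fK gK); apply: eq_big => x; last by rewrite fixn_tr.
  rewrite pst_tr_taut; congr (_ && _).
  exact: (hom_root (pmap_tr_hom fK x.1) None).
rewrite /tree_fps /all_forest_fps mulrA.
have -> : tree_sum 'I_n.+1
    = n.+1%:R * (u * \sum_(y : pst 'I_n | faut y) u ^+ fixn y.2).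
  rewrite /tree_sum mulr_natl -[in RHS](card_ord n.+1) -sumr_const.
  under [RHS]eq_bigr => r _ do rewrite -(trees_rooted r).
  rewrite (exchange_big_dep (@taut _)) => [|r x _ /andP[]] //=.
  apply: eq_bigr => x xt; have [r rP] := taut_froots xt.
  rewrite (big_pred1 r) // => i; rewrite xt /=; exact: (rP i).1.
rewrite factS natrM invrM ?(fact_unit natr_unit) //.
by rewrite [_ * (u * _)]mulrC mulrACA mulrV ?mulr1.
Qed.

End Counting.

(** * From labelled structures to isomorphism classes *)

(* As f is merely injective, this is an isomorphism only when #|V| = #|W|. *)
Definition isob (V W : finType) (p : pmap V) (q : pmap W) : bool :=
  [exists f : {ffun V -> W}, injectiveb f && [forall v, q (f v) == omap f (p v)]].

Lemma isob_intro (V W : finType) (p : pmap V) (q : pmap W) (f : V -> W) :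
  injective f -> hom p q f -> isob p q.
Proof.
move=> fI pqf; apply/existsP; exists (finfun f); apply/andP; split.
  by apply/injectiveP=> v w; rewrite !ffunE => /fI.
apply/forallP=> v; rewrite ffunE pqf.
by case: (p v) => //= w; rewrite ffunE.
Qed.

Lemma isob_elim (V W : finType) (p : pmap V) (q : pmap W) :
  #|V| = #|W| -> isob p q ->
  exists f g, [/\ cancel f g, cancel g f & hom p q f].
Proof.
move=> VW /existsP[f /andP[/injectiveP fI /forallP pqf]].
have [g fK gK] := inj_card_bij fI (eq_leq (esym VW)).
by exists f, g; split=> // v; apply/eqP.
Qed.

Lemma isob_refl (V : finType) (p : pmap V) : isob p p.
Proof. by apply: (@isob_intro _ _ p p id) => // v; rewrite omap_id. Qed.

Lemma hom_tr (V W : finType) (p : pmap V) (q : pmap W) f g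
  (gK : cancel g f) : hom p q f -> q = pmap_tr f g p.
Proof. by move=> pqf; apply/ffunP=> w; rewrite ffunE -pqf gK. Qed.

Lemma isob_sym (V W : finType) (p : pmap V) (q : pmap W) :
  #|V| = #|W| -> isob p q -> isob q p.
Proof.
move=> VW /(isob_elim VW)[f [g [fK gK pqf]]].
apply: (isob_intro (can_inj gK)) => w; rewrite -{2}(gK w) pqf.
by case: (p _) => //= v; rewrite fK.
Qed.

Lemma isob_trans (V W X : finType) (p : pmap V) (q : pmap W) (r : pmap X) :
  #|V| = #|W| -> #|W| = #|X| -> isob p q -> isob q r -> isob p r.
Proof.
move=> VW WX /(isob_elim VW)[f [g [fK gK pqf]]] /(isob_elim WX)[h [k [hK kK qrh]]].
apply: (@isob_intro _ _ _ _ (h \o f)) => [|v].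
  exact: inj_comp (can_inj hK) (can_inj fK).
by rewrite /= qrh pqf; case: (p v).
Qed.

Lemma iso_isob (V : finType) (p q : pmap V) : iso p q = isob p q.
Proof.
apply/existsP/idP=> [[s /morphP]|/(isob_elim erefl)[f [g [fK _ pqf]]]].
  exact: isob_intro perm_inj.
exists (perm (can_inj fK)); apply/morphP=> v; rewrite permE pqf.
by case: (p v) => //= w; rewrite permE.
Qed.

Definition relabel (V : finType) (p : pmap V) (s : {perm V}) : pmap V :=
  [ffun v => omap s (p (s^-1%g v))].

Lemma relabel1 (V : finType) : (@relabel V)^~ 1%g =1 id.
Proof.
move=> p; apply/ffunP=> v; rewrite ffunE invg1 perm1.
by case: (p v) => //= w; rewrite perm1.
Qed.

Lemma relabelM (V : finType) (p : pmap V) : act_morph (@relabel V) p.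
Proof.
move=> s t; apply/ffunP=> v; rewrite !ffunE invMg permM.
by case: (p _) => //= w; rewrite permM.
Qed.

Definition relabel_action (V : finType) := TotalAction (@relabel1 V) (@relabelM V).

Lemma morphE (V : finType) (p q : pmap V) s : morph p q s = (relabel p s == q).
Proof.
apply/morphP/eqP=> [h | <- v]; last by rewrite ffunE permK.
by apply/ffunP=> v; rewrite ffunE -h permKV.
Qed.

(** Orbit-stabilizer for the symmetric group acting by relabelling: the orbit is the isomorphism
    class, the stabilizer the automorphism group. *)
Lemma card_iso_class (V : finType) (p : pmap V) :
  (#|iso_class p| * #|Aut_pmap p|)%N = #|V|`!.
Proof.
have -> : iso_class p = orbit (relabel_action V) setT p.
  apply/setP=> q; rewrite inE; apply/existsP/imsetP=> [[s]|[s _ ->]]; last first.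
    by exists s; rewrite morphE.
  by rewrite morphE => /eqP <-; exists s.
have -> : Aut_pmap p = 'C_setT[p | relabel_action V]%g.
  by apply/setP=> s; rewrite !inE sub1set inE morphE.
rewrite card_orbit_stab -cardsT -card_perm; apply: eq_card => s.
by rewrite !inE; apply/esym/subsetP=> v _; rewrite inE.
Qed.

Section ClassSums.
Variables (R : comUnitRingType) (w : nat -> R).

(** Conjugation by an isomorphism maps one automorphism group onto the other and keeps the number of
    fixed points. *)
Lemma Aut_isob (V W : finType) (p : pmap V) (q : pmap W) :
  #|V| = #|W| -> isob p q ->
  #|Aut_pmap p| = #|Aut_pmap q| /\
  \sum_(s in Aut_pmap p) w (fixn s) = \sum_(s in Aut_pmap q) w (fixn s).
Proof.
move=> VW /(isob_elim VW)[f [g [fK gK pqf]]].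
have -> : Aut_pmap q = perm_tr fK gK @: Aut_pmap p.
  rewrite (hom_tr gK pqf); apply/setP=> s; apply/idP/imsetP=> [qs|[t pt ->]].
    have sE : s = perm_tr fK gK (perm_tr gK fK s).
      by apply/permP=> x; rewrite !permE !gK.
    exists (perm_tr gK fK s); last exact: sE.
    by move: qs; rewrite [in X in X -> _]sE !inE pmap_tr_morph.
  by move: pt; rewrite !inE pmap_tr_morph.
have trI : injective (perm_tr fK gK).
  move=> s t /permP st; apply/permP=> v.
  by have := st (f v); rewrite !perm_trE => /(can_inj fK).
split; first by rewrite card_imset.
rewrite big_imset => [|s t _ _ /trI //].
by apply: eq_bigr => s _; rewrite fixn_tr.
Qed.

Hypothesis natr_unit : forall n, (n.+1%:R : R) \is a GRing.unit.

(** The [q i] represent each isomorphism class in [P] once, on node types that may vary with [i],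
    which covers both [rep] and [fpmap]. A class has |V|! / |Aut| labelled members, all with the
    same inner sum. *)
Lemma class_sum (V I : finType) (W : I -> finType) (q : forall i, pmap (W i))
    (P : pred (pmap V)) :
  (forall i, #|W i| = #|V|) ->
  (forall p, P p -> exists i, isob (q i) p) ->
  (forall i j (p : pmap V), isob (q i) p -> isob (q j) p -> i = j) ->
  (forall i (p : pmap V), isob (q i) p -> P p) ->
  \sum_i (\sum_(s in Aut_pmap (q i)) w (fixn s)) / #|Aut_pmap (q i)|%:R
  = (\sum_(x : pst V | P x.1 && morph x.1 x.1 x.2) w (fixn x.2)) / #|V|`!%:R.
Proof.
move=> cW q_ex q_uniq qP; pose S (p : pmap V) := \sum_(s in Aut_pmap p) w (fixn s).
(* The sum over [i] has exactly one term: it only records the class of [p]. *)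
have -> : \sum_(x : pst V | P x.1 && morph x.1 x.1 x.2) w (fixn x.2)
    = \sum_(p | P p) \sum_(i | isob (q i) p) S p.
  transitivity (\sum_(p | P p) S p).
    by rewrite pair_big_dep /=; apply: eq_bigl => x; rewrite inE.
  apply: eq_bigr => p /q_ex[i qi]; rewrite (big_pred1 i) // => j.
  by apply/idP/eqP=> [qj|->//]; apply: q_uniq qj qi.
rewrite (exchange_big_dep xpredT) //= mulr_suml; apply: eq_bigr => i _.
have [f [g [fK gK]]] := card_eq_can (cW i).
pose p := pmap_tr f g (q i).
have qp : isob (q i) p := isob_intro (can_inj fK) (pmap_tr_hom fK _).
have isoE p' : P p' && isob (q i) p' = (p' \in iso_class p).
  rewrite inE iso_isob; apply/andP/idP=> [[_ qp']|pp'].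
    by apply: isob_trans (isob_sym _ qp) qp' => //; rewrite cW.
  by have qp' := isob_trans (cW i) erefl qp pp'; rewrite (qP _ _ qp').
have [-> ->] := Aut_isob (cW i) qp.
rewrite (eq_bigl _ _ isoE) -/(S p).
have -> : \sum_(p' in iso_class p) S p' = S p *+ #|iso_class p|.
  rewrite -sumr_const; apply: eq_bigr => p'.
  by rewrite inE iso_isob /S => /(Aut_isob erefl)[_ ->].
rewrite -(card_iso_class p) natrM -(mulr_natl (S p)).
have AU : (#|Aut_pmap p|%:R : R) \is a GRing.unit.
  by rewrite -(prednK (cardG_gt0 (Aut_pmap_group p))).
have CU : (#|iso_class p|%:R : R) \is a GRing.unit.
  rewrite -(@prednK #|iso_class p|) //; apply/card_gt0P; exists p.
  by rewrite inE iso_isob isob_refl.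
by rewrite [_ * S p]mulrC invrM // mulrACA mulrV // mulr1.
Qed.

End ClassSums.

(** * Polya trees *)

Lemma isob_rtree (V W : finType) (p : pmap V) (q : pmap W) :
  #|V| = #|W| -> isob p q -> rtree p -> rtree q.
Proof.
move=> VW /(isob_elim VW)[f [g [fK gK pqf]]] /rtreeP[pf [r rE]].
apply/rtreeP; split; first by apply: hom_rforest_onto pqf _ pf => w; exists (g w).
exists (f r) => w; rewrite -[w]gK (hom_root pqf) rE.
by rewrite (inj_eq (can_inj fK)).
Qed.

Lemma iso_class_eq (V : finType) (p q : pmap V) :
  isob p q -> iso_class p = iso_class q.
Proof.
move=> pq; apply/setP=> r; rewrite !inE !iso_isob.
by apply/idP/idP; apply: isob_trans => //; apply: isob_sym.
Qed.

Lemma ptree_val n (T : ptree n) : val T = iso_class (rep T).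
Proof.
have := repP T; have /imsetP[p _ ->] := valP T.
by rewrite inE iso_isob => /iso_class_eq.
Qed.

Lemma rtree_rep n (T : ptree n) : rtree (rep T).
Proof.
have := repP T; have /imsetP[p pt ->] := valP T.
by rewrite inE iso_isob => /(isob_rtree erefl); apply; rewrite inE in pt.
Qed.

Lemma ptree_ex n (p : pmap 'I_n) : rtree p -> exists T : ptree n, isob (rep T) p.
Proof.
move=> pt; have CP : is_ptree (iso_class p) by apply: imset_f; rewrite inE.
exists (Sub (iso_class p) CP); apply: isob_sym => //; rewrite -iso_isob.
by have := repP (Sub (iso_class p) CP : ptree n); rewrite SubK inE.
Qed.

Lemma ptree_uniq n (T T' : ptree n) : isob (rep T) (rep T') -> T = T'.
Proof. by move=> TT'; apply: val_inj; rewrite !ptree_val (iso_class_eq TT'). Qed.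

Lemma card_Aut_unit (R : comUnitRingType) (V : finType) (p : pmap V) :
  (forall n, (n.+1%:R : R) \is a GRing.unit) ->
  (#|Aut_pmap p|%:R : R) \is a GRing.unit.
Proof.
by move=> natr_unit; rewrite -(prednK (cardG_gt0 (Aut_pmap_group p))).
Qed.

Lemma tree_fps_class (R : comUnitRingType) (u : R) n :
  (forall n, (n.+1%:R : R) \is a GRing.unit) ->
  tree_fps u n = \sum_(T : ptree n)
    (\sum_(s in Aut_pmap (rep T)) u ^+ fixn s) / #|Aut_pmap (rep T)|%:R.
Proof.
move=> natr_unit; rewrite (class_sum (fun k => u ^+ k) natr_unit (P := @rtree 'I_n)) //.
- by rewrite card_ord.
- exact: ptree_ex.
- move=> T T' p Tp T'p; apply: ptree_uniq.
  by apply: isob_trans Tp (isob_sym _ T'p).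
- by move=> T p /isob_rtree; apply=> //; apply: rtree_rep.
Qed.

Lemma tree_fps_poly n : tree_fps 'X n = \sum_(T : ptree n) tpoly T.
Proof.
rewrite (tree_fps_class _ _ natr_unit_poly); apply: eq_bigr => T _.
by rewrite /tpoly -mul_polyC mulrC -polyCV polyC_natr.
Qed.

Lemma Tser_tree_fps n : Tser n = tree_fps 1 n.
Proof.
rewrite (tree_fps_class _ _ natr_unit_rat) /Tser -sumr_const; apply: eq_bigr => T _.
under eq_bigr => s _ do rewrite expr1n.
by rewrite sumr_const divff // -unitfE card_Aut_unit //; exact: natr_unit_rat.
Qed.

(** Both images are projections of the image of the pairing of [f] and [g], on which each projection
    is injective. *)
Lemma card_imset_eq (I A B : finType) (f : I -> A) (g : I -> B) (D : {set I}) :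
  (forall i j, (f i == f j) = (g i == g j)) ->
  #|f @: D| = #|g @: D|.
Proof.
move=> fg; pose h i := (f i, g i).
have imf : f @: D = fst @: (h @: D) by rewrite -imset_comp.
have img : g @: D = snd @: (h @: D) by rewrite -imset_comp.
have fstI : {in h @: D &, injective fst}.
  move=> x y /imsetP[i _ ->] /imsetP[j _ ->] /= /eqP; rewrite fg => /eqP ij.
  by congr (_, _) => //; apply/eqP; rewrite fg ij.
have sndI : {in h @: D &, injective snd}.
  move=> x y /imsetP[i _ ->] /imsetP[j _ ->] /= /eqP; rewrite -fg => /eqP ij.
  by congr (_, _) => //; apply/eqP; rewrite -fg ij.
by rewrite imf img (card_in_imset fstI) (card_in_imset sndI).
Qed.

Lemma pointed_isoP (V : finType) (x y : pmap V * V) :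
  reflect (exists2 s : {perm V}, morph x.1 y.1 s & s x.2 = y.2) (pointed_iso x y).
Proof.
by apply: (iffP existsP) => [[s /andP[? /eqP]]|[s ? /eqP sE]]; exists s => //; apply/andP.
Qed.

(** Every pointed tree can be moved onto the representative, where two pointings are isomorphic
    exactly when an automorphism relates the nodes. *)
Lemma card_pointings n (T : ptree n) :
  #|pointings T|
  = #|[set orbit 'P%act (Aut_pmap_group (rep T)) v | v in [set: 'I_n]]|.
Proof.
pose p := rep T.
have inv (a b : pmap 'I_n) (s : {perm 'I_n}) : morph a b s -> morph b a s^-1%g.
  rewrite !morphE => /eqP <-.
  by rewrite -(relabelM a s) mulgV relabel1.
have comp (a b c : pmap 'I_n) (s t : {perm 'I_n}) :
    morph a b s -> morph b c t -> morph a c (s * t)%g.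
  by rewrite !morphE => /eqP <- /eqP <-; rewrite (relabelM a s t).
have classE (x y : pmap 'I_n * 'I_n) :
    (pointed_class x == pointed_class y) = pointed_iso x y.
  apply/eqP/pointed_isoP=> [/setP/(_ y)|[s xys sE]].
    rewrite !inE => yx; apply/pointed_isoP; rewrite yx; apply/pointed_isoP.
    by exists 1%g; rewrite ?perm1 // morphE relabel1.
  apply/setP=> z; rewrite !inE; apply/pointed_isoP/pointed_isoP => -[t xzt tE].
    exists (s^-1 * t)%g; first exact: comp (inv _ _ _ xys) xzt.
    by rewrite permM -sE permK.
  by exists (s * t)%g; rewrite ?permM ?sE //; apply: comp xys xzt.
have -> : pointings T = [set pointed_class (p, v) | v in [set: 'I_n]].
  apply/setP=> C; apply/imset2P/imsetP=> [[q v]|[v _ ->]]; last first.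
    by exists p v => //; apply: repP.
  rewrite ptree_val inE => /existsP[s pqs] _ ->; exists (s^-1%g v) => //.
  apply/eqP; rewrite classE; apply/pointed_isoP; exists s^-1%g => //.
  exact: inv.
apply: card_imset_eq => v w; rewrite classE [RHS]eq_sym orbit_eq_mem.
by apply/pointed_isoP/orbitP=> -[s ps sE]; exists s => //; move: ps; rewrite inE.
Qed.

(** The derivative of u^(s_1) at 1 is s_1, so the left side is the average number of fixed nodes,
    that is, the number of orbits. *)
Lemma tpoly_deriv1 n (T : ptree n) : (tpoly T)^`().[1] = #|pointings T|%:R.
Proof.
pose G := Aut_pmap_group (rep T).
have := Frobenius_Cauchy (G := G) (S := [set: 'I_n]) (to := 'P%act).
have -> : [acts G, on [set: 'I_n] | 'P] by apply/actsP => s _ v; rewrite !inE.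
move/(_ isT) => FC.
rewrite /tpoly derivZ raddf_sum hornerZ horner_sum card_pointings.
have GU : (#|G|%:R : rat) != 0.
  by rewrite -unitfE card_Aut_unit //; exact: natr_unit_rat.
apply: (mulfI GU); rewrite mulrA divff // mul1r -natrM mulnC -FC natr_sum /=.
apply: eq_bigr => s _; rewrite derivXn hornerMn hornerXn expr1n; congr (_%:R).
by apply: eq_card => v; rewrite in_set in_setI in_setT; apply/eqP/afix1P.
Qed.

(** * Forests as multisets of Polya trees *)

Section ForestTypes.
Variable n : nat.
Implicit Types (V : finType) (T : ptree_upto n).

(** An isomorphism from [T] to the component of [r], written as a map into [V] so that components
    can remain subsets. *)
Definition is_emb V (p : pmap V) (r : V) T (f : {ffun 'I_(tag T) -> V}) : bool :=
  [&& injectiveb f, [forall v, p (f v) == omap f (rep (tagged T) v)]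
    & f @: setT == comp p r].

Definition has_type V (p : pmap V) (r : V) T : bool :=
  [exists f, @is_emb V p r T f].

Lemma has_typeP V (p : pmap V) r T :
  reflect (exists f : 'I_(tag T) -> V,
    [/\ injective f, hom (rep (tagged T)) p f & f @: setT = comp p r])
    (has_type p r T).
Proof.
apply: (iffP existsP) => [[f /and3P[/injectiveP fI /forallP fh /eqP fr]] |
                          [f [fI fh fr]]].
  by exists f; split=> // v; apply/eqP.
exists (finfun f); apply/and3P; split.
- by apply/injectiveP=> v w; rewrite !ffunE => /fI.
- apply/forallP=> v; rewrite ffunE fh; case: (rep _ v) => //= w.
  by rewrite ffunE.
- by rewrite -fr; apply/eqP/eq_imset => v; rewrite ffunE.
Qed.

Definition emb V (p : pmap V) (r : V) T : 'I_(tag T) -> V :=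
  odflt [ffun=> r] [pick f | @is_emb V p r T f].

Lemma embP V (p : pmap V) r T : has_type p r T ->
  [/\ injective (emb p r (T := T)), hom (rep (tagged T)) p (emb p r (T := T))
    & emb p r (T := T) @: setT = comp p r].
Proof.
move=> /existsP[f0 f0P]; rewrite /emb; case: pickP => [f|/(_ f0)]; last by rewrite f0P.
by case/and3P=> /injectiveP ? /forallP h /eqP ?; split=> // v; apply/eqP.
Qed.

Lemma has_type_comp V (p : pmap V) r T : has_type p r T -> #|comp p r| = tag T.
Proof.
by case/has_typeP=> f [fI _ <-]; rewrite card_imset // cardsT card_ord.
Qed.

Lemma has_type_uniq V (p : pmap V) r T T' :
  has_type p r T -> has_type p r T' -> T = T'.
Proof.
move=> rT rT'; have := has_type_comp rT; rewrite (has_type_comp rT') => /val_inj.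
case: T T' rT rT' => [k T] [k' T'] /= rT rT' kk'; subst k'.
case/has_typeP: rT => f [fI fh fr]; case/has_typeP: rT' => f' [fI' fh' fr'].
congr (existT _ _ _); apply: ptree_uniq.
(* Both embeddings have the same image; following one and inverting the other gives the
   isomorphism. *)
have ff' v : {v' | f v = f' v'}.
  have : f v \in f' @: setT by rewrite fr' -fr imset_f.
  case/imsetP/sig2_eqW => v' _; by exists v'.
pose g v := sval (ff' v).
have gE v : f v = f' (g v) := svalP (ff' v).
apply: (@isob_intro _ _ _ _ g) => [v w|v].
  by move/(congr1 f'); rewrite -!gE => /fI.
have := fh v; rewrite gE fh'; rewrite /=; case: (rep _ _) (rep _ _) => [a|] [b|] //=.
by rewrite gE => -[/fI' ->].
Qed.

(** The component is closed under parents, so numbering its nodes turns it into a tree on ['I_#|S|];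
    the bound on [#|V|] keeps its size within [ptree_upto n]. *)
Lemma has_type_ex V (p : pmap V) r : (#|V| <= n)%N -> rforest p -> p r = None ->
  exists T, has_type p r T.
Proof.
move=> le_Vn pf pr; pose S := comp p r.
have rS : r \in S by rewrite inE rt_id.
pose e (i : 'I_#|S|) : V := enum_val i.
pose d v : 'I_#|S| := enum_rank_in rS v.
have eS i : e i \in S := enum_valP i.
have dK v : v \in S -> e (d v) = v by move=> vS; apply: enum_rankK_in.
have eI : injective e by apply: enum_val_inj.
pose q : pmap 'I_#|S| := [ffun i => omap d (p (e i))].
have qe : hom q p e.
  move=> i; rewrite ffunE; case pe: (p (e i)) => [w|] //=; rewrite dK //.
  by rewrite inE (rt_up pf pe) -(in_set (fun v => rt p v == r)) eS.
have qt : rtree q.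
  apply/rtreeP; split; first exact: hom_rforest qe pf.
  exists (d r) => i; rewrite -(hom_root qe); apply/eqP/eqP=> [pi|->]; last by rewrite dK.
  by apply: eI; rewrite dK //; have := eS i; rewrite inE rt_id // => /eqP.
have Sn : (#|S| < n.+1)%N by rewrite ltnS (leq_trans _ le_Vn) ?max_card.
have [T qT] := ptree_ex qt.
have [f [g [fK gK fh]]] := isob_elim erefl qT.
exists (existT _ (Ordinal Sn) T : ptree_upto n); apply/has_typeP.
exists (e \o f); split.
- exact: inj_comp eI (can_inj fK).
- by move=> v /=; rewrite qe fh; case: (rep _ _).
- apply/setP=> v; apply/imsetP/idP=> [[i _ ->]|vS]; first exact: eS.
  by exists (g (d v)); rewrite //= gK dK.
Qed.

Definition roots_of_type V (p : pmap V) T : {set V} :=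
  [set r | (p r == None) && has_type p r T].

Lemma roots_of_type_hom V W (p : pmap V) (q : pmap W) f g T :
  cancel f g -> cancel g f -> rforest p -> hom p q f ->
  forall r, r \in roots_of_type p T -> f r \in roots_of_type q T.
Proof.
move=> fK gK pf pqf r; rewrite !inE (hom_root pqf) => /andP[-> /has_typeP[e [eI eh er]]].
have qf : rforest q by apply: hom_rforest_onto pqf _ pf => w; exists (g w).
apply/has_typeP; exists (f \o e); split.
- exact: inj_comp (can_inj fK) eI.
- by move=> v; rewrite /= pqf eh; case: (rep _ _).
apply/setP=> w; rewrite imset_comp er -[w]gK (mem_imset _ _ (can_inj fK)) !inE.
by rewrite (hom_rt pqf) // (inj_eq (can_inj fK)).
Qed.

Lemma card_roots_of_type V W (p : pmap V) (q : pmap W) T :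
  #|V| = #|W| -> rforest p -> isob p q ->
  #|roots_of_type p T| = #|roots_of_type q T|.
Proof.
have le V' W' (p' : pmap V') (q' : pmap W') :
    #|V'| = #|W'| -> rforest p' -> isob p' q' ->
    (#|roots_of_type p' T| <= #|roots_of_type q' T|)%N.
  move=> VW pf /(isob_elim VW)[f [g [fK gK pqf]]].
  rewrite -(card_imset _ (can_inj fK)); apply/subset_leq_card/subsetP=> _ /imsetP[r rT ->].
  exact: roots_of_type_hom pqf _ rT.
move=> VW pf pq; apply/eqP; rewrite eqn_leq !le //; last exact: isob_sym.
have [f [g [fK gK pqf]]] := isob_elim VW pq.
by apply: hom_rforest_onto pqf _ pf => w; exists (g w).
Qed.

(** The components partition the nodes and each has exactly one type. Hence the numbers of roots of
    each type are the multiplicities of a multiset of the right size. *)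
Lemma sum_roots_of_type V (p : pmap V) : (#|V| <= n)%N -> rforest p ->
  (\sum_T #|roots_of_type p T| * tag T)%N = #|V|.
Proof.
move=> le_Vn pf.
transitivity (\sum_T \sum_(r in roots_of_type p T) #|comp p r|)%N.
  apply: eq_bigr => T _; rewrite -sum_nat_const; apply: eq_bigr => r.
  by rewrite inE => /andP[_ /has_type_comp].
rewrite (exchange_big_dep (fun r => p r == None)) /= => [|T r _]; last first.
  by rewrite inE => /andP[].
transitivity (\sum_(r | p r == None) #|comp p r|)%N.
  apply: eq_bigr => r pr; have [T rT] := has_type_ex le_Vn pf (eqP pr).
  rewrite (big_pred1 T) // => T'; rewrite inE pr /=; apply/idP/eqP=> [rT'|->//].
  exact: has_type_uniq rT' rT.
rewrite -sum1_card [RHS](partition_big (rt p) (fun r => p r == None)) /=; last first.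
  by move=> v _; rewrite rt_root.
by apply: eq_bigr => r _; rewrite -sum1_card; apply: eq_bigl => v; rewrite inE.
Qed.

Section Multiset.
Variable F : mset_ptree n.

Definition copy T (i : 'I_(val F T)) (v : 'I_(tag T)) : fnode F :=
  Tagged (fun T => ('I_(val F T) * 'I_(tag T))%type) (i, v).

Lemma copy_hom T (i : 'I_(val F T)) : hom (rep (tagged T)) (fpmap F) (copy i).
Proof. by move=> v; rewrite ffunE. Qed.

Lemma fnode_copy (x : fnode F) : x = copy (tagged x).1 (tagged x).2.
Proof. by case: x => T [i v]. Qed.

Lemma card_fnode : #|fnode F| = n.
Proof.
rewrite card_tagged sumnE big_map big_enum -[RHS](eqP (valP F)).
by apply: eq_bigr => T _; rewrite card_prod !card_ord.
Qed.

Lemma rforest_rep T : rforest (rep (tagged T)).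
Proof. by have /andP[] := rtree_rep (tagged T). Qed.

Lemma fpmap_rforest : rforest (fpmap F).
Proof.
apply/rforestP=> x; rewrite [x]fnode_copy.
have [k kv] := elimT (rforestP _) (rforest_rep (tag x)) (tagged x).2; exists k.
by apply/eqP; rewrite (hom_iter_up (copy_hom _)) (hom_root (copy_hom _)) kv.
Qed.

Lemma fpmap_has_type T (i : 'I_(val F T)) v :
  rep (tagged T) v = None -> has_type (fpmap F) (copy i v) T.
Proof.
move=> vr; apply/has_typeP; exists (copy i); split; [|exact: copy_hom|].
  by move=> a b /eqP; rewrite eq_Tagged => /eqP[].
have /rtreeP[_ [r rE]] := rtree_rep (tagged T).
apply/setP=> x; apply/imsetP/idP=> [[w _ ->]|].
  rewrite inE (hom_rt (copy_hom _) _ fpmap_rforest).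
  have /eqP -> : v == r by rewrite -rE vr.
  by have := rE (rt (rep (tagged T)) w); rewrite rt_root ?rforest_rep // => /esym/eqP ->.
rewrite inE [in X in X -> _](fnode_copy x) (hom_rt (copy_hom _) _ fpmap_rforest).
case: x => T' [i' v'] /= /eqP xE; have TT' := congr1 tag xE; rewrite /= in TT'.
subst T'; move/eqP: xE; rewrite eq_Tagged => /eqP[-> _].
by exists v'.
Qed.

(** A root has a unique type, so those of type [T] lie in the copies of [T], one in each. *)
Lemma fpmap_roots_of_type T : #|roots_of_type (fpmap F) T| = val F T.
Proof.
have /rtreeP[_ [r rE]] := rtree_rep (tagged T).
have rr : rep (tagged T) r = None by apply/eqP; rewrite rE.
rewrite -[RHS]card_ord -cardsT -(card_imset _ (f := fun i => copy i r)); last first.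
  by move=> i j /eqP; rewrite eq_Tagged => /eqP[].
apply: eq_card => x; apply/idP/imsetP=> [|[i _ ->]]; last first.
  by rewrite inE fpmap_has_type // (hom_root (copy_hom _)) rr.
rewrite inE => /andP[]; rewrite (fnode_copy x) (hom_root (copy_hom _)).
case: x => T' [i v] /= /eqP vr /has_type_uniq/(_ (fpmap_has_type i vr)) TT'.
subst T'; exists i => //; congr copy; apply/eqP; by rewrite -rE vr.
Qed.

(** The i-th copy of [T] is embedded onto the component of the i-th root of type [T]; the root of an
    image node therefore determines the copy, which gives injectivity. *)
Lemma fpmap_isob V (p : pmap V) : #|V| = n -> rforest p ->
  (forall T, val F T = #|roots_of_type p T| :> nat) -> isob (fpmap F) p.
Proof.
move=> Vn pf FE.
pose r T (i : 'I_(val F T)) := enum_val (cast_ord (FE T) i).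
have rT T (i : 'I_(val F T)) : r T i \in roots_of_type p T by apply: enum_valP.
have rC T (i : 'I_(val F T)) : has_type p (r T i) T.
  by have := rT T i; rewrite inE => /andP[].
pose f (x : fnode F) : V := emb p (r (tag x) (tagged x).1) (tagged x).2.
have rtf x : rt p (f x) = r (tag x) (tagged x).1.
  have [_ _ /setP/(_ (f x))] := embP (rC (tag x) (tagged x).1).
  by rewrite {1}/f imset_f // => /esym; rewrite inE => /eqP.
apply: (@isob_intro _ _ _ _ f) => [x y xy|x].
  have : r (tag x) (tagged x).1 = r (tag y) (tagged y).1 by rewrite -!rtf xy.
  case: x y xy => [T [i v]] [T' [j w]] /= xy rij.
  have TT' : T = T' by apply: has_type_uniq (rC T i) _; rewrite rij.
  subst T'; have ij : i = j by apply/(cast_ord_inj (eq_n := FE T))/enum_val_inj.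
  subst j; have [eI _ _] := embP (rC T i).
  by have -> : v = w by apply: eI.
rewrite [in RHS](fnode_copy x) copy_hom /f.
have [_ -> _] := embP (rC (tag x) (tagged x).1).
by case: (rep _ _).
Qed.

End Multiset.

Lemma mset_ex (p : pmap 'I_n) :
  rforest p -> exists F : mset_ptree n, isob (fpmap F) p.
Proof.
move=> pf; have cn : (#|'I_n| <= n)%N by rewrite card_ord.
pose F0 : {ffun ptree_upto n -> 'I_n.+1} := [ffun T => inord #|roots_of_type p T|].
have F0E T : F0 T = #|roots_of_type p T| :> nat.
  by rewrite ffunE inordK // ltnS (leq_trans (max_card _)).
have F0n : (\sum_T F0 T * tag T)%N == n.
  rewrite (eq_bigr (fun T => #|roots_of_type p T| * tag T)%N) => [|T _]; last by rewrite F0E.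
  by rewrite sum_roots_of_type // card_ord.
exists (Sub F0 F0n : mset_ptree n); apply: fpmap_isob => //; first by rewrite card_ord.
Qed.

(** The multiplicities are recovered as numbers of roots of each type, an isomorphism invariant. *)
Lemma mset_uniq (F G : mset_ptree n) (p : pmap 'I_n) :
  isob (fpmap F) p -> isob (fpmap G) p -> F = G.
Proof.
move=> Fp Gp; apply/val_inj/ffunP=> T; apply: val_inj => /=.
have cE (H : mset_ptree n) :
    isob (fpmap H) p -> val H T = #|roots_of_type p T| :> nat.
  move=> Hp; rewrite -(@fpmap_roots_of_type H T).
  by apply: card_roots_of_type Hp; rewrite ?fpmap_rforest // card_fnode card_ord.
by rewrite (cE F Fp) (cE G Gp).
Qed.

Lemma forest_class_sum (R : comUnitRingType) (w : nat -> R) :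
  (forall m, (m.+1%:R : R) \is a GRing.unit) ->
  \sum_(F : mset_ptree n)
    (\sum_(s in Aut_pmap (fpmap F)) w (fixn s)) / #|Aut_pmap (fpmap F)|%:R
  = (\sum_(x : pst 'I_n | faut x) w (fixn x.2)) / n`!%:R.
Proof.
move=> natr_unit; rewrite (class_sum w natr_unit (P := @rforest 'I_n)) //.
- by rewrite card_ord.
- by move=> F; rewrite card_fnode card_ord.
- exact: mset_ex.
- exact: mset_uniq.
move=> F p Fp; have [|f [g [fK gK fh]]] := isob_elim _ Fp.
  by rewrite card_fnode card_ord.
by apply: hom_rforest_onto fh _ (fpmap_rforest F) => v; exists (g v).
Qed.

(* The root of a tree that occurs exactly once is fixed. *)
Lemma fixn_mset1 (F : mset_ptree n) s :
  ~~ mset_ge2 F -> s \in Aut_pmap (fpmap F) -> (0 < fixn s)%N.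
Proof.
case/forallPn=> T /negPn/eqP FT; rewrite inE => /morphP sh.
have /cards1P[r rE] : #|roots_of_type (fpmap F) T| == 1%N.
  by rewrite fpmap_roots_of_type FT.
have := @roots_of_type_hom _ _ _ _ _ _ T (permK s) (permKV s) (fpmap_rforest F) sh r.
rewrite rE !inE eqxx => /(_ isT) /eqP sr.
by apply/card_gt0P; exists r; rewrite inE sr.
Qed.

End ForestTypes.

(** * Enumeration of multisets *)

Section LogDerivative.

(* c is z B' / B up to degree N. *)
Definition log_deriv N (c B : fps rat) : Prop :=
  B 0%N = 1 /\ forall k, (k <= N)%N -> euler B k = fps_mul c B k.

Lemma log_derivM N c d A B : log_deriv N c A -> log_deriv N d B ->
  log_deriv N (fun k => c k + d k) (fps_mul A B).
Proof.
move=> [A0 cA] [B0 dB]; split; first by rewrite /fps_mul big_ord1 A0 B0 mulr1.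
move=> k le_kN; rewrite eulerM fps_mulDl fps_mulA; congr (_ + _).
  by apply: fps_mul_local => // i le_ik; rewrite cA // (leq_trans le_ik).
transitivity (fps_mul A (fps_mul d B) k).
  by apply: fps_mul_local => // i le_ik; rewrite dB // (leq_trans le_ik).
by rewrite !fps_mulA; apply: fps_mul_local => // i _; rewrite fps_mulC.
Qed.

(** As c has no constant term, k B_k is a combination of the B_j with j < k, and k can be divided
    out. *)
Lemma log_deriv_uniq N c A B : c 0%N = 0 -> log_deriv N c A -> log_deriv N c B ->
  forall k, (k <= N)%N -> A k = B k.
Proof.
move=> c0 [A0 cA] [B0 cB] k; have [m] := ubnP k.
elim: m k => // m IHm [|k] lt_km le_kN; first by rewrite A0 B0.
apply: (mulrI (natr_unit_rat k)); rewrite -[LHS]/(euler A _) -[RHS]/(euler B _).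
rewrite cA // cB // /fps_mul [LHS]big_ord_recl [RHS]big_ord_recl c0 !mul0r.
congr (_ + _).
apply: eq_bigr => i _; rewrite IHm // lift0 subSS.
  by rewrite (leq_trans _ (lt_km : (k < m)%N)) // ltnS leq_subr.
by rewrite (leq_trans _ le_kN) // (leq_trans (leq_subr _ _)).
Qed.

Lemma log_deriv_exp N A : A 0%N = 0 -> log_deriv N (euler A) (fps_exp A).
Proof.
move=> A0; split; first exact: fps_exp0.
by move=> k _; rewrite (euler_exp natr_unit_rat _ A0).
Qed.

(** Up to degree [N], [B] is 1/(1 - z^s), and its logarithmic derivative s z^s/(1 - z^s) has
    coefficient s at each positive multiple of s. *)
Lemma log_deriv_geom N s (B : fps rat) : (0 < s)%N ->
  (forall k, (k <= N)%N -> B k = (s %| k)%:R) ->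
  log_deriv N (fun m => ((0 < m) && (s %| m))%N%:R * s%:R) B.
Proof.
move=> s_gt0 BE; split=> [|k le_kN]; first by rewrite BE ?dvdn0.
rewrite /euler BE //.
transitivity (\sum_(i < k.+1) ((0 < i) && (s %| i))%N%:R * (s %| k)%:R * s%:R : rat).
  rewrite -!mulr_suml.
  have [sk|_] := boolP (s %| k)%N; last by rewrite !(mulr0, mul0r).
  rewrite !mulr1 -natr_sum -natrM; congr (_%:R).
  (* The quotient of k by s is the number of multiples of s between 1 and k. *)
  rewrite -[LHS](divnK sk); congr (_ * _)%N.
  rewrite big_ord_recl add0n divn_count_dvd big_add1 big_mkord /=.
  by apply: eq_bigr.
apply: eq_bigr => i _; rewrite BE ?(leq_trans (leq_subr _ _)) // mulrAC.
have [si|_] := boolP (s %| i)%N; last by rewrite andbF !mul0r.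
by rewrite dvdn_subl // -ltnS.
Qed.

Lemma log_deriv_prod N (I : finType) (c : I -> fps rat) (B : I -> {poly rat}) :
  (forall i, log_deriv N (c i) (fun k => (B i)`_k)) ->
  log_deriv N (fun k => \sum_i c i k) (fun k => (\prod_i B i)`_k).
Proof.
move=> cB; pose K (d : fps rat) (Q : {poly rat}) := log_deriv N d (fun k => Q`_k).
have K_ext d d' Q : (forall k, d k = d' k) -> K d Q -> K d' Q.
  move=> dd' [Q0 dQ]; split=> // k le_kN; rewrite dQ //.
  by apply: fps_mul_local => i _.
suff: forall r : seq I, K (fun k => \sum_(i <- r) c i k) (\prod_(i <- r) B i).
  by apply.
elim=> [|i r IHr].
  rewrite big_nil; split=> [|k _]; first by rewrite coef1.
  rewrite /euler coef1 /fps_mul big1 => [|j _]; last by rewrite big_nil mul0r.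
  by case: k => [|k]; rewrite ?mul0r ?mulr0.
have [K0 KE] := log_derivM (cB i) IHr.
apply: (K_ext (fun k => c i k + \sum_(i <- r) c i k)) => [k|]; first by rewrite big_cons.
rewrite big_cons; split=> [|k le_kN]; first by rewrite coefM.
rewrite /euler coefM; apply: (etrans (KE k le_kN)).
by apply: fps_mul_local => // j _; rewrite coefM.
Qed.

End LogDerivative.

Section CountMultisets.
Variable N : nat.
Let X := ptree_upto N.

(** The exponent j is the multiplicity of [T]; up to degree [N] this is the series 1/(1 - z^|T|). *)
Let geom (T : X) : {poly rat} := \sum_(j < N.+1) 'X^(j * tag T).

Lemma card_mset_coef : #|{: mset_ptree N}|%:R = (\prod_T geom T)`_N.
Proof.
rewrite /geom bigA_distr_bigA coef_sum card_sig -sum1_card natr_sum big_mkcond /=.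
apply: eq_bigr => F _; rewrite prodrXr coefXn inE eq_sym.
by case: ifP.
Qed.

Lemma ptree_gt0 n (T : ptree n) : (0 < n)%N.
Proof.
by case: n T => // T; have /rtreeP[_ [[]]] := rtree_rep T.
Qed.

Lemma geomE T k : (k <= N)%N -> (geom T)`_k = (tag T %| k)%:R.
Proof.
have T_gt0 := ptree_gt0 (tagged T).
move=> le_kN; rewrite /geom coef_sum.
under eq_bigr => j _ do rewrite coefXn.
have [/dvdnP[q kE]|kT] := boolP (tag T %| k)%N; last first.
  rewrite big1 // => j _; case: eqP => // kE; case/negP: kT.
  by rewrite kE dvdn_mull.
have lt_qN : (q < N.+1)%N by rewrite ltnS (leq_trans _ le_kN) // kE leq_pmulr.
rewrite (bigD1 (Ordinal lt_qN)) //= -kE eqxx big1 ?addr0 // => j.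
rewrite -val_eqE /= kE eqn_pmul2r // eq_sym => /negPf ->.
by [].
Qed.

(** The full exponent, the sum of T(z^i)/i over all i >= 1. *)
Definition Pser : fps rat := fun k => Tser k + Tser_tail k.

Lemma Tser0 : Tser 0 = 0.
Proof.
rewrite /Tser (_ : #|{: ptree 0}| = 0%N) //; apply: eq_card0 => T.
by have := ptree_gt0 T.
Qed.

Lemma PserE k :
  Pser k = \sum_(i < k.+1 | ((0 < i) && (i %| k))%N) Tser (k %/ i)%N / i%:R.
Proof.
rewrite -(big_mkord (fun i => (0 < i) && (i %| k))%N
  (fun i => Tser (k %/ i)%N / i%:R)).
rewrite big_ltn_cond // /= /Pser /Tser_tail.
case: k => [|k]; first by rewrite !big_geq // Tser0 addr0.
rewrite big_ltn_cond //= dvd1n divn1 divr1; congr (_ + _).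
rewrite [RHS]big_mkcond; apply: eq_big_nat => i /andP[lt1i _] /=.
by rewrite /fps_zpow; case: ifP; rewrite ?(ltnW lt1i) //= mul0r.
Qed.

(** Both sides are, for k > 0, the sum of d t_d over the divisors d of k. *)
Lemma euler_Pser k : (k <= N)%N ->
  \sum_(T : X) ((0 < k) && (tag T %| k))%N%:R * (tag T)%:R = euler Pser k.
Proof.
case: k => [_|k le_kN].
  by rewrite /euler mul0r big1 // => T _; rewrite mul0r.
pose P d := ((0 < d) && (d %| k.+1))%N.
transitivity (\sum_(d < k.+2 | P d) d%:R * Tser d).
  rewrite (big_ord_widen_cond N.+1 P (fun d => d%:R * Tser d)) ?ltnS //.
  rewrite -(sig_big_dep xpredT (fun _ => xpredT)
    (fun (d : 'I_N.+1) (T : ptree d) => ((0 < k.+1) && (d %| k.+1))%N%:R * d%:R)) /=.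
  rewrite [RHS]big_mkcond /=; apply: eq_bigr => d _; rewrite sumr_const.
  rewrite -[LHS]mulr_natr -/(Tser d) /P; have [dk|_] /= := boolP (d %| k.+1)%N.
    by rewrite (dvdn_gt0 _ dk) //= mul1r ltnS dvdn_leq.
  by rewrite andbF /= !mul0r.
rewrite /euler PserE mulr_sumr.
(* This involution on the divisors exchanges the tree size d with the index i of T(z^i). *)
pose h (i : 'I_k.+2) : 'I_k.+2 := inord (k.+1 %/ i).
have hE i : h i = (k.+1 %/ i)%N :> nat by rewrite inordK // ltnS leq_div.
have PK i : P i -> (P (k.+1 %/ i) && (k.+1 %/ (k.+1 %/ i) == i))%N.
  rewrite /P => /andP[i_gt0 ik]; rewrite divn_gt0 // dvdn_leq //= dvdn_div //.
  by rewrite divnA // mulKn // eqxx.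
rewrite (reindex_onto h h) => [|i /PK/andP[_ /eqP hhi]]; last first.
  by apply: val_inj; rewrite /= !hE.
have condE i : P (h i) && (h (h i) == i) = P i.
  rewrite -val_eqE /= !hE; apply/idP/idP; last exact: PK.
  by case/andP=> /PK/andP[Pi _] /eqP <-.
rewrite (eq_bigl _ _ condE); apply: eq_bigr => i /andP[i_gt0 /dvdnP[q kE]].
rewrite hE; move: (nat_of_ord i) i_gt0 kE => {}i i_gt0 ->.
rewrite mulnK // natrM -mulrA; congr (_ * _).
by rewrite mulrC divfK // pnatr_eq0 -lt0n.
Qed.

(** The product of the geometric series and the product of the two exponentials have constant term 1
    and the same logarithmic derivative up to degree [N]. *)
Lemma card_mset : #|{: mset_ptree N}|%:R = fps_mul (fps_exp Tser) Dser N.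
Proof.
have tail0 : Tser_tail 0 = 0 by rewrite /Tser_tail big_geq.
have prodP := log_deriv_prod
  (fun T : X => log_deriv_geom (ptree_gt0 (tagged T)) (@geomE T)).
have expP := log_derivM (log_deriv_exp N Tser0) (log_deriv_exp N tail0).
rewrite card_mset_coef; apply: (log_deriv_uniq _ _ expP (leqnn N)).
  by rewrite /euler !mul0r addr0.
case: prodP => g0 gE; split=> // k le_kN; rewrite gE //.
apply: fps_mul_local => // i le_ik; rewrite euler_Pser ?(leq_trans le_ik) //.
by rewrite /euler -mulrDr.
Qed.

End CountMultisets.

(** * Conclusion *)

(** Without a fixed root there is no fixed node, so every weight is u^0 = 1 and the sum is
    independent of u. *)
Lemma forest_sum0 (R : comUnitRingType) (u : R) (V : finType) :
  forest_sum u V 0 = #|[set x : pst V | faut x & fixn x.2 == 0%N]|%:R.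
Proof.
rewrite /forest_sum -sum1_card natr_sum; apply: eq_big => x.
  by rewrite inE; apply: andb_id2l => /fixn_eq0 ->.
by case/andP=> /fixn_eq0 <- /eqP ->.
Qed.

Lemma all_forest_fps_count n : all_forest_fps 1 n = #|{: mset_ptree n}|%:R :> rat.
Proof.
rewrite /all_forest_fps -(forest_class_sum n (fun k => 1 ^+ k) natr_unit_rat).
rewrite -sumr_const; apply: eq_bigr => F _.
under eq_bigr => s _ do rewrite expr1n.
by rewrite sumr_const divff // -unitfE card_Aut_unit //; exact: natr_unit_rat.
Qed.

(* At u = 1 both sides times exp(T) count all multisets of trees. *)
Lemma Dser_forest_fps n : Dser n = forest_fps 1 0 n.
Proof.
apply: (fps_mulI (fps_exp0 Tser0)) => {}n; rewrite -card_mset -all_forest_fps_count.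
rewrite (all_forest_fpsE _ natr_unit_rat); apply: fps_mul_local => // i _.
by apply: fps_exp_local => j _; rewrite Tser_tree_fps.
Qed.

(** Independence of u carries the value found at u = 1 over [rat] to the variable ['X] over
    [{poly rat}]. *)
Lemma Dser_polyC n : (Dser n)%:P = forest_fps 'X 0 n.
Proof.
rewrite Dser_forest_fps /forest_fps !forest_sum0 polyCM polyC_natr.
by rewrite -polyCV polyC_natr.
Qed.

Lemma Dser_mset n :
  Dser n = \sum_(F : mset_ptree n | mset_ge2 F)
    #|[set s in Aut_pmap (fpmap F) | fixn s == 0%N]|%:R / #|Aut_pmap (fpmap F)|%:R.
Proof.
(* With this weight the class sums count the automorphisms without fixed nodes. *)
pose w k : rat := (k == 0%N)%:R.
have wE (I : finType) (P : pred I) (f : I -> nat) :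
    \sum_(i | P i) w (f i) = #|[set i | P i & f i == 0%N]|%:R.
  rewrite -sum1_card natr_sum big_mkcond [RHS]big_mkcond; apply: eq_bigr => i _.
  by rewrite inE; case: (P i) => //=; rewrite /w; case: eqP.
rewrite Dser_forest_fps /forest_fps forest_sum0 -wE.
rewrite -(forest_class_sum n w natr_unit_rat) [RHS]big_mkcond /=.
(* A multiset with a tree of multiplicity one has a zero numerator, by [fixn_mset1]. *)
apply: eq_bigr => F _; rewrite wE; case: ifPn => // F1.
rewrite (_ : [set _ | _ & _] = set0) ?cards0 ?mul0r //.
apply/setP=> s; rewrite !inE; apply/negP=> /andP[sF /eqP s0].
by have := @fixn_mset1 n F s F1; rewrite s0 inE => /(_ sF).
Qed.

Lemma is_Tc_tree_fps : is_Tc (tree_fps 'X).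
Proof.
split=> [|[|n]]; rewrite ?tree_fps0 // (tree_fpsS _ natr_unit_poly).
rewrite (all_forest_fpsE _ natr_unit_poly); congr (_ * _).
by apply: fps_mul_local => // i _; rewrite Dser_polyC.
Qed.

Theorem theorem2 :
  (forall n : nat,
     Dser n =
     \sum_(F : mset_ptree n | mset_ge2 F)
        #|[set s in Aut_pmap (fpmap F) | fixn s == 0%N]|%:R
          / #|Aut_pmap (fpmap F)|%:R)
  /\ (forall Tc : fps {poly rat}, is_Tc Tc ->
        forall n : nat, Tc n = \sum_(T : ptree n) tpoly T)
  /\ (forall (n : nat) (T : ptree n),
        (tpoly T)^`().[1] = #|pointings T|%:R).
Proof.
split; first exact: Dser_mset.
split; last exact: tpoly_deriv1.
by move=> Tc TcP n; rewrite (is_Tc_unique TcP is_Tc_tree_fps) tree_fps_poly.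
Qed.
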